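(* Let $t\ge 0$ be an integer and let $\epsilon\in\mathbb{R}$ satisfy $0<\epsilon\ll 1$. There exists a digraph $G$ with nonnegative edge costs on $\nu=\nu(t,\epsilon)=O((t/\epsilon)^{(t/\epsilon)})$ vertices such that, for the metric completion $H$ of $G$, the integrality ratio of the level-$t$ Sherali–Adams tightening of the balanced LP relaxation of ATSP on $H$ is at least $1+\frac{1-\epsilon}{t+1}$.
   Context: Metric completion: for a digraph $G=(V,E)$ with nonnegative edge costs $c$, its metric completion is the complete digraph $H$ on $V$ in which the cost $c'(v,w)$ of edge $(v,w)$ is the minimum $c$-cost of a $v$–$w$ dipath in $G$. Balanced LP of ATSP on a complete digraph $H=(V,E_H)$: variables $x_e$, $e\in E_H$; minimize $\sum_e c'_e x_e$ subject to $x(\delta^{in}(S))\ge 1$ and $x(\delta^{out}(S))\ge 1$ for all $\emptyset\subsetneq S\subsetneq V$, $x(\delta^{out}(\{v\}))=x(\delta^{in}(\{v\}))$ for all $v\in V$, and $0\le x\le 1$. Here $\delta^{out}(U)$ ($\delta^{in}(U)$) is the set of edges leaving (entering) $U$ and $x(F)=\sum_{e\in F}x_e$. Let $\hat P$ denote its feasible polytope. Sherali–Adams: let $\hat P\subseteq[0,1]^n$ be a polytope given by a finite system of linear inequalities $\sum_{i=1}^n a_i y_i\ge b$ (the system includes $0\le y_i\le 1$ for all $i$; equations are written as two inequalities). For an integer $t\ge0$, the level-$t$ Sherali–Adams tightening $SA^t(\hat P)$ is the set of vectors $y=(y_S)$ indexed by subsets $S\subseteq\{1,\dots,n\}$ with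 $|S|\le t+1$, with $y_\emptyset=1$, such that for every inequality $\sum_i a_i y_i\ge b$ of the system and every pair of disjoint sets $S,Q\subseteq\{1,\dots,n\}$ with $|S|+|Q|\le t$: $\sum_{i=1}^n a_i\sum_{T\subseteq Q}(-1)^{|T|}y_{S\cup T\cup\{i\}}\ \ge\ b\sum_{T\subseteq Q}(-1)^{|T|}y_{S\cup T}$. Integrality ratio of the instance: the minimum cost of a Hamiltonian dicycle in $H$ (w.r.t. $c'$) divided by $\min\{\sum_{e}c'_e\,y_{\{e\}} : y\in SA^t(\hat P)\}$. *)

(* Defs.v *)
(* MathComp / MathComp-Analysis *)
From HB Require Import structures.
From mathcomp Require Import all_boot all_order all_algebra.
From mathcomp Require Import classical_sets reals exp.

Set Implicit Arguments.
Unset Strict Implicit.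
Unset Printing Implicit Defensive.

Import Order.TTheory GRing.Theory Num.Theory.
Local Open Scope ring_scope.

Definition is_min (R : realType) (A : set R) (m : R) : Prop :=
  A m /\ lbound A m.

Record cost_digraph (R : realType) := CostDigraph {
  vertex : finType;
  arc : rel vertex;
  arc_irr : irreflexive arc;
  cost : vertex -> vertex -> R;  (* only meaningful on arcs *)
  cost_ge0 : forall v w, arc v w -> 0 <= cost v w
}.

Section MetricCompletion.
Context (R : realType) (G : cost_digraph R).

(* The dipath visiting v and then, in order, the vertices of p. *)
Definition is_dipath (v w : vertex G) (p : seq (vertex G)) : bool :=
  [&& path (@arc R G) v p, last v p == w & uniq (v :: p)].

Definition dipath_cost (v : vertex G) (p : seq (vertex G)) : R :=
  \sum_(a <- pairmap (@cost R G) v p) a.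

(* Since each minimum has to exist, this also forces G to be strongly
   connected; the values of c' on the diagonal are irrelevant. *)
Definition is_metric_completion (c' : vertex G -> vertex G -> R) : Prop :=
  forall v w, v != w ->
    is_min [set dipath_cost v p | p in [set p | is_dipath v w p]]%classic
           (c' v w).

End MetricCompletion.

Section SheraliAdams.
Context (R : realType) (I : finType).

(* (a, b) stands for the inequality \sum_i a i * y_i >= b. *)
Definition ineq : Type := {ffun I -> R} * R.

(* Only the coordinates y S with #|S| <= t.+1 occur below, so a total function
   on {set I} stands for the vector indexed by those sets. *)
Definition sherali_adams (t : nat) (sys : seq ineq) (y : {set I} -> R) : Prop :=
  y finset.set0 = 1 /\
  forall (a : {ffun I -> R}) (b : R), (a, b) \in sys ->
  forall S Q : {set I}, [disjoint S & Q] -> (#|S| + #|Q| <= t)%N ->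
    \sum_(i : I) a i *
      (\sum_(T : {set I} | T \subset Q)
         (-1) ^+ #|T| * y (S :|: T :|: [set i])) >=
    b * (\sum_(T : {set I} | T \subset Q) (-1) ^+ #|T| * y (S :|: T)).

End SheraliAdams.

Section BalancedLP.
Context (R : realType) (V : finType).

(* The edges of the complete digraph on V. *)
Definition cedge : Type := {e : V * V | e.1 != e.2}.
HB.instance Definition _ := Finite.on cedge.

Definition etail (e : cedge) : V := (val e).1.
Definition ehead (e : cedge) : V := (val e).2.

Definition dout (U : {set V}) : {set cedge} :=
  [set e | (etail e \in U) && (ehead e \notin U)].
Definition din (U : {set V}) : {set cedge} :=
  [set e | (etail e \notin U) && (ehead e \in U)].

(* The coefficient vector of x(F). *)
Definition ind (F : {set cedge}) : {ffun cedge -> R} :=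
  [ffun e => (e \in F)%:R].

Definition proper_cuts : seq {set V} :=
  [seq U <- enum {set V} | (U != finset.set0) && (U != [set: V])].

Definition balanced_lp : seq (ineq R cedge) :=
     [seq (ind (din U), 1) | U <- proper_cuts]
  ++ [seq (ind (dout U), 1) | U <- proper_cuts]
  ++ [seq (ind (dout [set v]) - ind (din [set v]), 0) | v <- enum V]
  ++ [seq (ind (din [set v]) - ind (dout [set v]), 0) | v <- enum V]
  ++ [seq (ind [set e], 0) | e <- enum {: cedge}]
  ++ [seq (- ind [set e], -1) | e <- enum {: cedge}].

Definition is_ham_dicycle (s : seq V) : Prop :=
  ucycle [rel v w | v != w] s /\ forall v, v \in s.

Definition dicycle_cost (c : V -> V -> R) (s : seq V) : R :=
  \sum_(v <- s) c v (next s v).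

Definition sa_cost (c : V -> V -> R) (y : {set cedge} -> R) : R :=
  \sum_(e : cedge) c (etail e) (ehead e) * y [set e].

(* rho is the integrality ratio of SA^t of the balanced LP on the complete
   digraph on V with edge costs c. *)
Definition is_integrality_ratio (t : nat) (c : V -> V -> R) (rho : R) : Prop :=
  exists opt lp : R,
    [/\ is_min [set dicycle_cost c s | s in is_ham_dicycle]%classic opt,
        is_min [set sa_cost c y | y in sherali_adams t balanced_lp]%classic lp,
        0 < lp
      & rho = opt / lp].

End BalancedLP.

(* This is (t/eps)^(t/eps) for t >= t0, where t0 is the threshold of the
   asymptotic bound. Smaller t are treated as t0, because the formula
   degenerates at t = 0. *)
Definition growth (R : realType) (t0 t : nat) (eps : R) : R :=
  let z := (maxn t t0)%:R / eps in z `^ z.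

(* Main.v *)
Require Import Defs.
From HB Require Import structures.
From mathcomp Require Import all_boot all_order all_algebra.
From mathcomp Require Import boolp classical_sets reals exp.
From mathcomp Require Import topology normedtype derive.
From mathcomp Require Import zify ring lra.

Set Implicit Arguments.
Unset Strict Implicit.
Unset Printing Implicit Defensive.

Import Order.TTheory GRing.Theory Num.Theory.
Local Open Scope ring_scope.

(* The instance is the recursive digraph of Charikar, Goemans and Karloff. A copy of level k+1
   strings r copies of level k between two antiparallel rails of arcs of cost (r+1)^k: one rail
   runs through the sources of the children, the other one back through their sinks.
   Integral side: a tour is an integral connected circulation. If the flow through a child is
   non-zero, the rail flow changes there, and the excess on the rails is worth at least what the
   child saves; summing over the levels, the savings telescope and only the top level may lose
   (r+1)^k. Hence a tour costs almost as much as all arcs together.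
   Fractional side: the arcs decompose into dicycles (cells), and deleting any single cell leaves
   the digraph connected and balanced. Hence "delete at most one random cell, each with
   probability 1/(t+2)" is a pseudo-distribution on feasible integral points that is consistent
   up to level t; its cost is (t+1)/(t+2) times the cost of all arcs. *)

(** * Sherali-Adams vectors from arc colourings *)

Section AlternatingSum.
Variables (R : realType) (I : finType).

(** The sum is the expansion of a product with one factor $-1+1$ for each element of [B]; the value
    0 off [B] discards the subsets not contained in [B]. *)
Lemma sum_subsets_sign (B : {set I}) :
  \sum_(T : {set I} | T \subset B) (-1) ^+ #|T| = (B == finset.set0)%:R :> R.
Proof.
have := @bigA_distr R 0 1 *%R +%R I (fun i => if i \in B then -1 else 0) (fun=> 1).
have -> : \prod_i ((if i \in B then -1 else 0) + 1 : R) = (B == finset.set0)%:R.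
  case: (set_0Vmem B) => [->|[i iB]].
    by rewrite eqxx big1 // => i _; rewrite inE add0r.
  rewrite (bigD1 i) //= iB addNr mul0r; case: eqP => // B0.
  by rewrite B0 inE in iB.
move=> ->; rewrite [LHS]big_mkcond; apply: eq_bigr => T _ /=.
rewrite -big_mkcond /=; case: ifPn => [/fintype.subsetP TB|/fintype.subsetPn[i iT iB]].
  by rewrite (eq_bigr (fun=> -1)) ?prodr_const // => i /TB ->.
by rewrite (bigD1 i) //= (negPf iB) mul0r.
Qed.

(** At the 0/1 point with support [A], the sum is the product of $x_i$ over $S\cup Z$ and of $1-x_i$
    over $Q$. Only subsets of $Q\cap A$ contribute, and they cancel unless this set is empty. *)
Lemma sum_subsets_incl (A S Q Z : {set I}) :
  \sum_(T : {set I} | T \subset Q) (-1) ^+ #|T| * ((S :|: T :|: Z) \subset A)%:R =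
  ((S :|: Z) \subset A)%:R * [disjoint Q & A]%:R :> R.
Proof.
under eq_bigr => T _ do rewrite finset.setUAC finset.subUset -mulnb natrM mulrCA.
rewrite -big_distrr /=; congr (_ * _).
rewrite -finset.setI_eq0 -sum_subsets_sign.
under [RHS]eq_bigl => T do rewrite finset.subsetI.
by rewrite big_mkcondr; apply: eq_bigr => T _; case: ifP; rewrite ?mulr1 ?mulr0.
Qed.

(** By linearity each point [B k] contributes its own slack if it contains [S] and avoids [Q], and
    nothing otherwise. Weights may be negative, so feasibility of the points alone does not settle
    the sign. *)
Lemma sherali_adams_mixture (K : finType) (W : K -> R) (B : K -> {set I})
    (y : {set I} -> R) (a : I -> R) (b : R) (S Q : {set I}) :
  (forall Z, y Z = \sum_k W k * (Z \subset B k)%:R) ->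
  \sum_i a i * (\sum_(T : {set I} | T \subset Q) (-1) ^+ #|T| * y (S :|: T :|: [set i]))
    - b * (\sum_(T : {set I} | T \subset Q) (-1) ^+ #|T| * y (S :|: T)) =
  \sum_(k | (S \subset B k) && [disjoint Q & B k]) W k * (\sum_(i in B k) a i - b).
Proof.
move=> yE.
have yT Z : \sum_(T : {set I} | T \subset Q) (-1) ^+ #|T| * y (S :|: T :|: Z) =
    \sum_(k | (S \subset B k) && [disjoint Q & B k]) W k * (Z \subset B k)%:R.
  under eq_bigr => T _ do rewrite yE mulr_sumr.
  rewrite exchange_big [RHS]big_mkcond; apply: eq_bigr => k _ /=.
  under eq_bigr => T _ do rewrite mulrCA.
  rewrite -mulr_sumr sum_subsets_incl finset.subUset.
  by case: (S \subset _) [disjoint _ & _] => -[]; rewrite ?mulr0 ?mul0r ?mulr1 ?mulr0.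
under eq_bigr => i _ do rewrite yT mulr_sumr.
rewrite exchange_big /=.
have -> : \sum_(T : {set I} | T \subset Q) (-1) ^+ #|T| * y (S :|: T) =
    \sum_(k | (S \subset B k) && [disjoint Q & B k]) W k.
  transitivity (\sum_(T : {set I} | T \subset Q) (-1) ^+ #|T| * y (S :|: T :|: finset.set0)).
    by apply: eq_bigr => T _; rewrite finset.setU0.
  by rewrite yT; apply: eq_bigr => k _; rewrite finset.sub0set mulr1.
rewrite mulr_sumr -sumrB; apply: eq_bigr => k _.
rewrite mulrBr (mulrC b); congr (_ - _).
rewrite [in RHS]big_mkcond /= mulr_sumr; apply: eq_bigr => i _.
by rewrite finset.sub1set mulrCA; case: (i \in _); rewrite ?mulr1 ?mulr0.
Qed.

End AlternatingSum.

(** * Feasibility and cost of the vector that deletes one random colour *)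

Section ColouredNetwork.
Variables (R : realType) (V A J : finType) (s t : A -> V) (col : A -> J).
Hypothesis st_neq : forall a, s a != t a.
Hypothesis st_inj : forall a b, s a = s b -> t a = t b -> a = b.
Hypothesis col_bal : forall (j : J) (g : V -> nat),
  (\sum_(a | col a == j) g (s a) = \sum_(a | col a == j) g (t a))%N.
Hypothesis col_conn : forall (j : J) (x : V -> bool),
  (forall a, col a != j -> x (s a) = x (t a)) -> forall u v, x u = x v.

Lemma big_by_colour (T : Type) (idx : T) (op : Monoid.com_law idx) (P : pred J) (F : A -> T) :
  \big[op/idx]_(a | P (col a)) F a =
  \big[op/idx]_(j | P j) \big[op/idx]_(a | col a == j) F a.
Proof.
rewrite (partition_big col P) //; apply: eq_bigr => j Pj; apply: eq_bigl => a.
by case: eqP => [->|]; rewrite ?Pj ?andbF.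
Qed.

Lemma bal_cond (P : pred J) (g : V -> nat) :
  (\sum_(a | P (col a)) g (s a) = \sum_(a | P (col a)) g (t a))%N.
Proof.
by rewrite !big_by_colour; apply: eq_bigr => j _; apply: col_bal.
Qed.

(* Both sides of a cut have the same number of arcs leaving, so a set that no arc leaves is
   not entered either. *)
Lemma col_cut (j : J) (U : pred V) : (exists v, U v) -> (exists v, ~~ U v) ->
  exists a, [&& col a != j, U (s a) & ~~ U (t a)].
Proof.
move=> [u Uu] [v Uv]; apply/existsP; apply: contraT => /existsPn H.
have le a : col a != j -> (U (s a) <= U (t a))%N.
  by move=> aj; have := H a; rewrite aj /=; case: (U (s a)) => //; case: (U (t a)).
have E : forall a, col a != j -> U (s a) = U (t a).
  move=> a aj; have := bal_cond (predC1 j) (fun v => U v : nat).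
  rewrite (bigD1 a) //= [RHS](bigD1 a) //=.
  have := le a aj; case: (U (s a)); case: (U (t a)) => // _ E.
  have : (\sum_(i | (col i != j) && (i != a)) U (s i) <=
      \sum_(i | (col i != j) && (i != a)) U (t i))%N.
    by apply: leq_sum => i /andP[ij _]; apply: le.
  by move: E; rewrite add0n => ->; rewrite ltnn.
by rewrite -(col_conn E u v) Uu in Uv.
Qed.

Definition arc_edge (a : A) : cedge V := exist _ (s a, t a) (st_neq a).

Lemma arc_edge_inj : injective arc_edge.
Proof. by move=> a b /(congr1 val) [/st_inj H /H]. Qed.

Definition all_edges : {set cedge V} := [set arc_edge a | a : A].
Definition edges_without (j : J) : {set cedge V} := [set arc_edge a | a : A & col a != j].

Variable level : nat.
Let p : R := (level.+2%:R)^-1.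

(* Up to level t it looks as if a colour were removed at random, each one with
   probability 1/(t+2); the weight of [None] may be negative. *)
Definition sa_weight (k : option J) : R := if k is Some _ then p else 1 - p *+ #|J|.
Definition sa_point (k : option J) : {set cedge V} :=
  if k is Some j then edges_without j else all_edges.
Definition sa_vector (Z : {set cedge V}) : R :=
  \sum_k sa_weight k * (Z \subset sa_point k)%:R.

(** The first two clauses are feasibility of the points. The third one compensates for the negative
    weight of [None]. *)
Definition slack_ok (a : {ffun cedge V -> R}) (b : R) : Prop :=
  [/\ forall j, b <= \sum_(i | col i != j) a (arc_edge i),
      b <= \sum_i a (arc_edge i) &
      forall P : pred J, \sum_(i | P (col i)) a (arc_edge i) <=
        2 * (\sum_i a (arc_edge i) - b)].

Lemma p_gt0 : 0 < p. Proof. by rewrite invr_gt0 ltr0n. Qed.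

Lemma sum_option (F : option J -> R) (P : pred (option J)) :
  \sum_(k | P k) F k = (if P None then F None else 0) + \sum_(j | P (Some j)) F (Some j).
Proof.
rewrite big_mkcond (bigD1 None) //= [in RHS]big_mkcond; congr (_ + _).
rewrite (reindex_omap Some id) /=; last by case.
by apply: eq_bigl => j; rewrite eqxx.
Qed.

Lemma sum_all_edges (a : cedge V -> R) :
  \sum_(i in all_edges) a i = \sum_i a (arc_edge i).
Proof. by rewrite big_imset //= => x y _ _; apply: arc_edge_inj. Qed.

Lemma sum_edges_without (a : cedge V -> R) j :
  \sum_(i in edges_without j) a i = \sum_(i | col i != j) a (arc_edge i).
Proof.
rewrite big_imset /=; last by move=> x y _ _; apply: arc_edge_inj.
by apply: eq_bigl => i; rewrite inE.
Qed.

(** Each edge of [S] has only one colour, so at most [#|S|] of the points [edges_without j] fail to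
    contain [S]. *)
Lemma card_hit (S : {set cedge V}) : S \subset all_edges ->
  (#|J| - #|S| <= #|[pred j | S \subset edges_without j]|)%N.
Proof.
move=> SE; rewrite leq_subLR addnC -(cardC [pred j | S \subset edges_without j]) leq_add2l.
pose T := [set i | arc_edge i \in S].
have TS : (#|T| <= #|S|)%N.
  rewrite -(card_imset (mem T) arc_edge_inj); apply: subset_leq_card.
  by apply/fintype.subsetP => e /imsetP[i]; rewrite inE => iS ->.
apply: leq_trans TS; apply: leq_trans (leq_imset_card col (mem T)).
apply: subset_leq_card; apply/fintype.subsetP => j; rewrite !inE.
case/fintype.subsetPn => e eS ej; have /imsetP[i _ ei] := fintype.subsetP SE e eS.
have iT : i \in T by rewrite inE -ei.
apply/imsetP; exists i => //; apply/esym/eqP; apply: contraNT ej => ij.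
by rewrite ei; apply/imsetP; exists i => //; rewrite inE.
Qed.

(** If the full point is inconsistent with [S] and [Q], only feasible points of positive weight
    remain. Otherwise the consistent points have total weight at least $2p$, and the third clause of
    [slack_ok] bounds what the deletions cost. *)
Lemma sa_vector_ineq a b (S Q : {set cedge V}) : slack_ok a b ->
  [disjoint S & Q] -> (#|S| + #|Q| <= level)%N ->
  \sum_i a i * (\sum_(T : {set cedge V} | T \subset Q)
      (-1) ^+ #|T| * sa_vector (S :|: T :|: [set i])) >=
  b * (\sum_(T : {set cedge V} | T \subset Q) (-1) ^+ #|T| * sa_vector (S :|: T)).
Proof.
move=> [okj ok ok2] SQ SQt; rewrite -subr_ge0.
rewrite (@sherali_adams_mixture _ _ _ sa_weight sa_point) // sum_option /=.
case: ifPn => [/andP[SE QE]|_]; last first.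
  rewrite add0r sumr_ge0 // => j _; apply: mulr_ge0; first exact: ltW p_gt0.
  by rewrite subr_ge0 sum_edges_without.
have sub j : edges_without j \subset all_edges.
  by apply/fintype.subsetP => e /imsetP[i _ ->]; apply: imset_f.
rewrite (eq_bigl (fun j => S \subset edges_without j)); last first.
  by move=> j; rewrite (disjointWr (sub j) QE) andbT.
set hit := fun j => S \subset edges_without j.
set sig := _ - b; have sE : sig = \sum_i a (arc_edge i) - b by rewrite /sig sum_all_edges.
(* The slack without colour [j] is [sig] minus the coefficients of that colour. *)
have -> : \sum_(j | hit j) p * (\sum_(i in edges_without j) a i - b) =
    p *+ #|[pred j | hit j]| * sig - p * \sum_(i | hit (col i)) a (arc_edge i).
  rewrite big_by_colour mulr_sumr -mulr_natl -mulrA mulrCA mulr_natl -sumr_const.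
  rewrite mulr_sumr -sumrB; apply: eq_bigr => j _.
  have := bigID (fun i => col i == j) xpredT (fun i => a (arc_edge i)).
  by rewrite -mulrBr sE sum_edges_without => -> /=; congr (_ * _); ring.
have hitJ : (#|J| - #|S| <= #|[pred j | hit j]|)%N := card_hit SE.
(* At most [level] colours are lost, so the remaining weight is at least $1-tp=2p$ for
   $p=1/(t+2)$. *)
have N1 : 2 * p <= 1 - p *+ #|J| + p *+ #|[pred j | hit j]|.
  have -> : 2 * p = 1 - p *+ level.
    rewrite -mulr_natr /p -(natr1 level.+1) -(natr1 level); field.
    by rewrite !natr1 pnatr_eq0.
  have : p *+ #|J| <= p *+ (#|[pred j | hit j]| + level).
    rewrite -!(mulr_natr p) ler_pM2l ?p_gt0 // ler_nat.
    move: #|J| #|S| #|Q| #|[pred j | hit j]| hitJ SQt => x1 x2 x3 x4 *; lia.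
  by rewrite mulrnDr; lra.
have s0 : 0 <= sig by rewrite sE subr_ge0.
have := ler_wpM2l (ltW p_gt0) (ok2 hit); rewrite -sE.
have := ler_wpM2r s0 N1.
move: (p *+ _) (p *+ _) (\sum_(i | hit _) _) => x y z.
lra.
Qed.

(** A cut that survives every deletion has two arcs: some [i1], and one that remains without the
    colour of [i1]. A total $x\ge2$ satisfies $x\le2(x-1)$, whence the factor 2 in [slack_ok]. *)
Lemma slack_ok_cut (j0 : J) (F : {set cedge V}) :
  (forall j, exists2 i, col i != j & arc_edge i \in F) -> slack_ok (ind R F) 1.
Proof.
move=> FP; have E i : ind R F (arc_edge i) = (arc_edge i \in F)%:R by rewrite ffunE.
have ge0 (P : pred A) : 0 <= \sum_(i | P i) ind R F (arc_edge i).
  by apply: sumr_ge0 => i _; rewrite E ler0n.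
have [i1 i1j i1F] := FP j0; have [i2 i2j i2F] := FP (col i1).
have i21 : i2 != i1 by apply: contraNneq i2j => ->.
have tot : 2 <= \sum_i ind R F (arc_edge i).
  rewrite (bigD1 i1) // (bigD1 i2) //= !E i1F i2F.
  by rewrite addrA lerDl ge0.
split=> [j| |P].
- have [i ij iF] := FP j; rewrite (bigD1 i) //= E iF lerDl; exact: ge0.
- by lra.
have : \sum_(i | P (col i)) ind R F (arc_edge i) <= \sum_i ind R F (arc_edge i).
  by rewrite [leRHS](bigID (fun i => P (col i))) /= lerDl ge0.
by lra.
Qed.

Lemma slack_ok_zero (a : {ffun cedge V -> R}) :
  (forall P : pred J, \sum_(i | P (col i)) a (arc_edge i) = 0) -> slack_ok a 0.
Proof.
move=> aP; split=> [j| |P]; rewrite ?(aP (predC1 j)) ?(aP predT) //.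
by rewrite aP subr0 mulr0.
Qed.

Lemma sum_ind_degree v (P : pred J) :
  \sum_(i | P (col i)) ind R (dout [set v]) (arc_edge i) =
  \sum_(i | P (col i)) ind R (din [set v]) (arc_edge i).
Proof.
(* Both sides indicate whether the arc is incident with [v]. *)
have E i : ind R (dout [set v]) (arc_edge i) + (t i == v)%:R =
    ind R (din [set v]) (arc_edge i) + (s i == v)%:R.
  rewrite !ffunE !inE /etail /ehead /=.
  have [sv|sv] := eqVneq (s i) v; have [tv|tv] := eqVneq (t i) v;
    rewrite ?addr0 ?add0r //.
have stE : \sum_(i | P (col i)) (s i == v)%:R = \sum_(i | P (col i)) (t i == v)%:R :> R.
  by rewrite -!natr_sum (bal_cond P (fun u => u == v : nat)).
have : \sum_(i | P (col i)) (ind R (dout [set v]) (arc_edge i) + (t i == v)%:R) =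
    \sum_(i | P (col i)) (ind R (din [set v]) (arc_edge i) + (s i == v)%:R).
  by apply: eq_bigr.
by rewrite big_split [RHS]big_split /= -stE; apply: addIr.
Qed.

Lemma balanced_lp_slack (j0 : J) a b : (a, b) \in balanced_lp R V -> slack_ok a b.
Proof.
have cut (U : {set V}) : U \in proper_cuts V -> [/\ exists v, v \in U, exists v, ~~ (v \in U),
     exists v, v \notin U & exists v, ~~ (v \notin U)].
  rewrite mem_filter => /andP[/andP[/set0Pn[u uU] UT] _].
  have [v vU] : exists v, v \notin U.
    by apply/existsP; rewrite -negb_forall; apply: contra UT => /forallP UV;
      apply/eqP/setP => v; rewrite UV inE.
  by split; [exists u|exists v|exists v|exists u; rewrite uU].
rewrite !mem_cat => /or4P[/mapP[U /cut[_ _ U1 U2] [-> ->]]|/mapP[U /cut[U1 U2 _ _] [-> ->]]|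
  /mapP[v _ [-> ->]]|/or3P[/mapP[v _ [-> ->]]|/mapP[e _ [-> ->]]|/mapP[e _ [-> ->]]]].
- apply: (slack_ok_cut j0) => j; have [i /and3P[ij si ti]] := col_cut j U1 U2.
  by exists i; rewrite // inE /etail /ehead /= si -(negbK (_ \in U)) ti.
- apply: (slack_ok_cut j0) => j; have [i /and3P[ij si ti]] := col_cut j U1 U2.
  by exists i; rewrite // inE /etail /ehead /= si ti.
- apply: slack_ok_zero => P.
  under eq_bigr => i _ do rewrite ffunE [X in _ + X]ffunE.
  by rewrite big_split /= sumrN sum_ind_degree subrr.
- apply: slack_ok_zero => P.
  under eq_bigr => i _ do rewrite ffunE [X in _ + X]ffunE.
  by rewrite big_split /= sumrN sum_ind_degree subrr.
- have ge0 (P : pred A) : 0 <= \sum_(i | P i) ind R [set e] (arc_edge i).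
    by apply: sumr_ge0 => i _; rewrite ffunE ler0n.
  split=> // P; rewrite subr0 [in leRHS](bigID (fun i => P (col i))) /=.
  have := ge0 (fun i => P (col i)); have := ge0 (fun i => ~~ P (col i)); lra.
have le1 (P : pred A) : 0 <= \sum_(i | P i) ind R [set e] (arc_edge i) <= 1.
  rewrite sumr_ge0 /= => [|i _]; last by rewrite ffunE ler0n.
  rewrite (eq_bigr (fun i => (arc_edge i == e)%:R)) => [|i _]; last by rewrite ffunE finset.in_set1.
  rewrite -natr_sum lern1 -big_mkcondr /= sum1_card.
  apply/card_le1_eqP => i1 i2 /andP[_ /eqP <-] /andP[_ /eqP].
  exact: arc_edge_inj.
have N (P : pred A) : \sum_(i | P i) (- ind R [set e]) (arc_edge i) =
    - \sum_(i | P i) ind R [set e] (arc_edge i).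
  by rewrite -sumrN; apply: eq_bigr => i _; rewrite ffunE.
split=> [j| |P]; rewrite !N.
- by have := le1 (fun i => col i != j); lra.
- by have := le1 predT; lra.
by have := le1 (fun i => P (col i)); have := le1 predT; lra.
Qed.

Lemma sa_vector_feasible (j0 : J) : sherali_adams level (balanced_lp R V) sa_vector.
Proof.
split=> [|a b /(balanced_lp_slack j0) ab S Q]; last exact: sa_vector_ineq.
rewrite /sa_vector sum_option /= finset.sub0set mulr1.
under eq_bigr do rewrite finset.sub0set mulr1.
by rewrite sumr_const subrK.
Qed.

(** The weights sum to 1 and each arc is missing from exactly one point, of weight $p$. *)
Lemma sa_vector_cost (c : V -> V -> R) :
  sa_cost c sa_vector = (1 - p) * \sum_i c (s i) (t i).
Proof.
pose F (e : cedge V) := c (etail e) (ehead e).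
have -> : sa_cost c sa_vector = \sum_k sa_weight k * \sum_(e in sa_point k) F e.
  rewrite /sa_cost /sa_vector; under eq_bigr => e _ do rewrite mulr_sumr.
  rewrite exchange_big; apply: eq_bigr => k _.
  rewrite [in RHS]big_mkcond mulr_sumr; apply: eq_bigr => e _.
  by rewrite finset.sub1set mulrCA /F; case: ifP; rewrite ?mulr1 ?mulr0.
rewrite sum_option /= sum_all_edges.
under eq_bigr => j _ do rewrite sum_edges_without.
rewrite -mulr_sumr.
have E j : \sum_(i | col i != j) F (arc_edge i) =
    \sum_i F (arc_edge i) - \sum_(i | col i == j) F (arc_edge i).
  by rewrite [in RHS](bigID (fun i => col i == j)) /= addrC addrK.
rewrite [X in p * X](eq_bigr _ (fun j _ => E j)).
rewrite sumrB sumr_const -(big_by_colour _ predT) /=.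
rewrite -(mulr_natr p) -(mulr_natr (\sum_i _)).
by rewrite /F; ring.
Qed.

End ColouredNetwork.

(** * Tours as circulations *)

Section UniqSeqMin.
Variables (R : realType) (V : finType).

(** Duplicate-free sequences have length at most [#|V|], so the minimum is over a finite type. *)
Lemma is_min_uniq_seq (P : set (seq V)) (f : seq V -> R) :
  (forall p, P p -> uniq p) -> (exists p, P p) ->
  exists m, is_min [set f p | p in P]%classic m.
Proof.
move=> Pu [p0 Pp0].
have sz p : P p -> (size p <= #|V|)%N by move=> /Pu /card_uniqP <-; apply: max_card.
pose b0 : #|V|.-bseq V := Bseq (sz _ Pp0).
case: (@arg_minP _ R _ b0 (fun p : #|V|.-bseq V => `[< P p >]) (fun p => f p)).
  exact/asboolP.
move=> b /asboolP Pb bmin; exists (f b); split; first by exists b.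
by move=> _ [p Pp <-]; apply: (bmin (Bseq (sz _ Pp))); apply/asboolP.
Qed.

End UniqSeqMin.

Section Network.
Variables (R : realType) (V A : finType) (s t : A -> V) (w : A -> nat).
Hypothesis st_neq : forall a, s a != t a.
Hypothesis st_inj : forall a b, s a = s b -> t a = t b -> a = b.

Definition net_arc : rel V := [rel u v | [exists a, (u, v) == (s a, t a)]].

Definition net_cost (u v : V) : R :=
  (\sum_a w a * ((u, v) == (s a, t a)))%N%:R.

Lemma net_arc_irr : irreflexive net_arc.
Proof.
move=> v; apply/existsP => -[a /eqP[vs vt]].
by have := st_neq a; rewrite -vs -vt eqxx.
Qed.

Lemma net_cost_ge0 u v : net_arc u v -> 0 <= net_cost u v.
Proof. by move=> _; apply: ler0n. Qed.

Definition network : cost_digraph R := CostDigraph net_arc_irr net_cost_ge0.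

Local Open Scope nat_scope.

Definition uses (u : V) (p : seq V) (a : A) : nat :=
  count_mem (s a, t a) (zip (u :: p) p).

Lemma uses_cons u v p a : uses u (v :: p) a = ((u, v) == (s a, t a)) + uses v p a.
Proof. by []. Qed.

Lemma dipath_cost_uses u p :
  dipath_cost (G := network) u p = (\sum_a w a * uses u p a)%:R%R.
Proof.
elim: p u => [|v p IH] u.
  by rewrite /dipath_cost big_nil big1 // => a _; rewrite muln0.
rewrite /dipath_cost /= big_cons; move: (IH v); rewrite /dipath_cost => ->.
rewrite /cost /= -natrD -big_split; congr (_%:R)%R; apply: eq_bigr => a _.
by rewrite uses_cons mulnDr.
Qed.

Lemma sum_arc (F : A -> nat) u v : net_arc u v ->
  exists2 a, (u, v) = (s a, t a) & \sum_b ((u, v) == (s b, t b)) * F b = F a.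
Proof.
case/existsP => a /eqP[ua va]; exists a; first by rewrite ua va.
rewrite (bigD1 a) //= ua va eqxx mul1n big1 ?addn0 // => b ba.
by case: eqP => // -[sE tE]; rewrite (st_inj sE tE) eqxx in ba.
Qed.

Lemma uses_conserve u p (g : V -> nat) : path net_arc u p ->
  \sum_a uses u p a * g (s a) + g (last u p) = \sum_a uses u p a * g (t a) + g u.
Proof.
elim: p u => [|v p IH] u /=; first by rewrite !big1 // => a _; rewrite mul0n.
case/andP => uv /IH {}IH.
have split h : \sum_a uses u (v :: p) a * g (h a) =
    \sum_a ((u, v) == (s a, t a)) * g (h a) + \sum_a uses v p a * g (h a).
  by rewrite -big_split; apply: eq_bigr => a _; rewrite uses_cons mulnDl.
rewrite !split.
have [a [ua _] ->] := sum_arc (fun a => g (s a)) uv.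
have [b [_ vb] ->] := sum_arc (fun a => g (t a)) uv.
by rewrite -ua -vb; lia.
Qed.

Lemma uses_crossing u p (U : pred V) : path net_arc u p -> U u -> ~~ U (last u p) ->
  exists a, [&& U (s a), ~~ U (t a) & 0 < uses u p a].
Proof.
elim: p u => [|v p IH] u /=; first by move=> _ ->.
case/andP => /existsP[a /eqP uv] /IH {}IH Uu Ul.
have [Uv|Uv] := boolP (U v).
  have [b /and3P[bs bt b0]] := IH Uv Ul.
  by exists b; rewrite bs bt uses_cons addn_gt0 b0 orbT.
by exists a; case: uv => us vt; rewrite -us -vt Uu Uv uses_cons us vt eqxx.
Qed.

(** Conservation is tested against arbitrary functions, so contracting a vertex set amounts to a
    choice of [g]. *)
Definition balanced_flow (m : A -> nat) :=
  forall g : V -> nat, \sum_a m a * g (s a) = \sum_a m a * g (t a).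

Definition connected_flow (m : A -> nat) := forall U : pred V,
  (exists v, U v) -> (exists v, ~~ U v) -> exists a, [&& U (s a), ~~ U (t a) & 0 < m a].

(** The successor map on the tour has a single orbit, so no proper non-empty set is invariant. *)
Lemma next_exit (q : seq V) (U : pred V) : uniq q -> (forall v, v \in q) ->
  (exists v, U v) -> (exists v, ~~ U v) -> exists v, U v && ~~ U (next q v).
Proof.
move=> qu qV [u Uu] [v Uv].
have [/existsP//|/existsPn H] := boolP [exists v, U v && ~~ U (next q v)].
have : fconnect (next q) u v by rewrite (fconnect_cycle (cycle_next qu)).
move/iter_findex => vE; case/negP: Uv; rewrite -vE.
by elim: (findex _ _ _) => //= n Un; have := H (iter n (next q) u); rewrite Un negbK.
Qed.

(** Each edge of the tour is replaced by a cheapest dipath, and [m] counts the traversals of each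
    arc. The ends of the dipaths cancel because [next] is a permutation; a cut left by the tour is
    left by one of the dipaths. *)
Lemma tour_flow (c : V -> V -> R) (q : seq V) :
  is_metric_completion (G := network) c -> is_ham_dicycle q ->
  exists m, [/\ balanced_flow m, connected_flow m &
    dicycle_cost c q = (\sum_a m a * w a)%:R%R].
Proof.
move=> cM [/andP[qc qu] qV].
have nextV v : v != next q v by have := next_cycle qc (qV v).
have /choice[P PP] : forall v, exists p, is_dipath (G := network) v (next q v) p /\
    dipath_cost (G := network) v p = c v (next q v).
  by move=> v; have [[p pP <-] _] := cM _ _ (nextV v); exists p.
have sumq (F : V -> nat) : \sum_(v <- q) F v = \sum_v F v.
  by rewrite big_uniq //; apply: eq_bigl => v; rewrite qV.
have Pp v : path net_arc v (P v) /\ last v (P v) = next q v.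
  by have [/and3P[? /eqP]] := PP v.
exists (fun a => \sum_v uses v (P v) a); split.
- move=> g; have swap h : \sum_a (\sum_v uses v (P v) a) * g (h a) =
      \sum_v \sum_a uses v (P v) a * g (h a).
    by rewrite exchange_big; apply: eq_bigr => a _; rewrite big_distrl.
  rewrite !swap; apply: (@addIn (\sum_v g (next q v))).
  have nE : \sum_v g (next q v) = \sum_v g v.
    by rewrite [RHS](reindex_inj (can_inj (prev_next qu))).
  rewrite [in RHS]nE -!big_split; apply: eq_bigr => v _ /=.
  by have [pv <-] := Pp v; apply: uses_conserve.
- move=> U U1 U0; have [v /andP[Uv Un]] := next_exit qu qV U1 U0.
  have [pv lv] := Pp v; rewrite -lv in Un.
  have [a /and3P[a1 a2 a3]] := uses_crossing pv Uv Un; exists a.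
  by rewrite a1 a2 (leq_trans a3) // (bigD1 v) // leq_addr.
rewrite /dicycle_cost; transitivity (\sum_(v <- q) (\sum_a w a * uses v (P v) a)%N%:R : R)%R.
  by apply: eq_bigr => v _; have [_ <-] := PP v; rewrite dipath_cost_uses.
rewrite -natr_sum sumq exchange_big; congr (_%:R)%R; apply: eq_bigr => a _ /=.
by rewrite -big_distrr mulnC.
Qed.

Lemma tour_exists : 1 < #|V| -> exists q : seq V, is_ham_dicycle q.
Proof.
rewrite cardE; move E : (enum V) => q; case: q E => [|u [|v q]] // E _.
have qu := enum_uniq V; rewrite E in qu.
exists [:: u, v & q]; split; last by move=> x; rewrite -E mem_enum.
rewrite /ucycle qu andbT /cycle rcons_path; apply/andP; split.
  by move: qu; rewrite uniq_pairwise => /pairwise_sorted.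
by apply: contraTneq qu => /= <-; rewrite mem_last.
Qed.

Hypothesis w_gt0 : forall a, 0 < w a.
Hypothesis cut : forall U : pred V,
  (exists v, U v) -> (exists v, ~~ U v) -> exists a, U (s a) && ~~ U (t a).

(** The cut condition gives strong connectivity. Positive integer weights give the bound 1, which
    later keeps the LP value positive; one-arc dipaths give the upper bound. *)
Lemma metric_completion_exists : exists c : V -> V -> R,
  [/\ is_metric_completion (G := network) c,
      forall u v, u != v -> (1 <= c u v)%R &
      forall a, (c (s a) (t a) <= (w a)%:R)%R].
Proof.
have conn u v : connect net_arc u v.
  apply: contraT => uv; have [||a /andP[us]] := cut (U := connect net_arc u).
  - by exists u; apply: connect0.
  - by exists v.
  apply: contraNT => _; apply: connect_trans us (connect1 _).
  by apply/existsP; exists a.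
have /choice[c cP] : forall uv : V * V, exists c : R, uv.1 != uv.2 ->
    is_min [set dipath_cost (G := network) uv.1 p |
      p in [set p | is_dipath (G := network) uv.1 uv.2 p]]%classic c.
  case=> u v /=; have [uv|uv] := eqVneq u v; first by exists 0%R.
  have [||m mP] := @is_min_uniq_seq R V
      [set p | is_dipath (G := network) u v p]%classic
      (dipath_cost (G := network) u).
  - by move=> p /and3P[_ _ /andP[]].
  - have /connectP[p pp ->] := conn u v.
    by case/shortenP: pp => p' p1 p2 _; exists p'; apply/and3P.
  by exists m.
exists (fun u v => c (u, v)); split.
- by move=> u v uv; apply: (cP (u, v)).
- move=> u v uv; have [[p /and3P[/= pp pl _] <-] _] := cP (u, v) uv.
  rewrite dipath_cost_uses ler1n; case: p pp pl => [_ /eqP /= E|x p /= /andP[/existsP[a aE] _] _].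
    by rewrite E eqxx in uv.
  by rewrite (bigD1 a) //= addn_gt0 muln_gt0 w_gt0 uses_cons addn_gt0 aE.
move=> a; have [_] := cP (s a, t a) (st_neq a); apply.
exists [:: t a].
  by rewrite /is_dipath /= !andbT eqxx inE st_neq !andbT; apply/existsP; exists a.
rewrite dipath_cost_uses; congr (_%:R)%R.
rewrite (bigD1 a) //= /uses /= eqxx muln1 big1 ?addn0 // => b ba.
by case: eqP => [[sE tE]|_]; rewrite ?muln0 // (st_inj sE tE) eqxx in ba *.
Qed.

End Network.

(** * Attainment of the Sherali-Adams optimum *)

Section LPMinimum.
Import numFieldNormedType.Exports.
Local Open Scope classical_set_scope.
Variables (R : realType) (V : finType).
Local Notation vec := 'rV[R]_#|{set cedge V}|.
Let coordinate (v : vec) (S : {set cedge V}) : R := v ord0 (enum_rank S).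

Lemma closed_forall (T : topologicalType) (I : Type) (P : I -> T -> Prop) :
  (forall i, closed [set v | P i v]) -> closed [set v | forall i, P i v].
Proof.
move=> Pc; have -> : [set v | forall i, P i v] = \bigcap_(i in setT) [set v | P i v].
  by apply/seteqP; split=> v /= H i; [move=> _; apply: H|exact: H].
by apply: closed_bigI => i _; apply: Pc.
Qed.

Lemma closed_imply (T : topologicalType) (D : Prop) (P : T -> Prop) :
  (D -> closed [set v | P v]) -> closed [set v | D -> P v].
Proof.
have [d|nd] := pselect D => Pc; last first.
  have -> : [set v | D -> P v] = setT by apply/seteqP; split=> // v _ /nd.
  exact: closedT.
have -> : [set v | D -> P v] = [set v | P v].
  by apply/seteqP; split=> v /= H //; apply: H.
exact: Pc.
Qed.

Lemma continuous_coordinate (S : {set cedge V}) : continuous (fun v : vec => coordinate v S).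
Proof. exact: coord_continuous. Qed.

Lemma continuous_scale (T : topologicalType) (k : R) (f : T -> R) :
  continuous f -> continuous (fun v => k * f v).
Proof. by move=> fc v; apply: continuousM; [exact: cst_continuous|exact: fc]. Qed.

Lemma continuous_lincomb (T : topologicalType) (I : finType) (P : pred I) (k : I -> R)
    (f : I -> T -> R) :
  (forall i, continuous (f i)) -> continuous (fun v => \sum_(i | P i) k i * f i v).
Proof.
move=> fc; apply: continuous_big => [|i _]; first exact: add_continuous.
exact: continuous_scale.
Qed.

Lemma closed_le_fun (T : topologicalType) (f g : T -> R) :
  continuous f -> continuous g -> closed [set v | f v <= g v].
Proof.
move=> fc gc; have -> : [set v | f v <= g v] = (fun v => g v - f v) @^-1` [set x | 0 <= x].
  by apply/seteqP; split=> v /=; rewrite subr_ge0.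
apply: (proj1 (continuous_closedP _)); last exact: closed_ge.
by move=> v; apply: cvgB; [exact: gc|exact: fc].
Qed.

Lemma sherali_adams_closed (t : nat) (sys : seq (ineq R (cedge V))) :
  closed [set v : vec | sherali_adams t sys (coordinate v)].
Proof.
apply: closedI.
  change (closed ((fun v : vec => coordinate v finset.set0) @^-1` [set x | x = 1])).
  apply: (proj1 (continuous_closedP _)); first exact: continuous_coordinate.
  exact: closed_eq.
do 2! apply: closed_forall => ?; apply: closed_imply => _.
do 2! apply: closed_forall => ?; do 2! apply: closed_imply => _.
apply: closed_le_fun.
  apply: continuous_scale; apply: continuous_lincomb => T; exact: continuous_coordinate.
by apply: continuous_lincomb => i; apply: continuous_lincomb => T; exact: continuous_coordinate.
Qed.

(** The case $Q=\emptyset$, in which the alternating sums collapse. *)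
Lemma sherali_adams_level0 t y a b : sherali_adams t (balanced_lp R V) y ->
  (a, b) \in balanced_lp R V ->
  forall S : {set cedge V}, (#|S| <= t)%N -> b * y S <= \sum_i a i * y (S :|: [set i])%SET.
Proof.
move=> [_ H] ab S St; have := H a b ab S finset.set0.
rewrite -finset.setI_eq0 finset.setI0 eqxx finset.cards0 addn0 => /(_ isT St).
have sub0 (F : {set cedge V} -> R) : \sum_(T : {set cedge V} | T \subset finset.set0) F T = F finset.set0.
  by rewrite (big_pred1 finset.set0) // => T; rewrite finset.subset0.
rewrite sub0 finset.cards0 expr0 mul1r finset.setU0.
by under eq_bigr => i _ do rewrite sub0 finset.cards0 expr0 mul1r finset.setU0.
Qed.

Lemma sum_ind1 (y : cedge V -> R) e : \sum_i ind R [set e]%SET i * y i = y e.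
Proof.
rewrite (bigD1 e) //= ffunE finset.set11 mul1r big1 ?addr0 // => i ie.
by rewrite ffunE finset.in_set1 (negPf ie) mul0r.
Qed.

(** Induction by removing some $e$ from $S$: the constraints $x_e\ge0$ and $x_e\le1$ give $0\le
    y_S\le y_{S\setminus e}$. *)
Lemma sherali_adams_range (t : nat) (y : {set cedge V} -> R) (S : {set cedge V}) :
  sherali_adams t (balanced_lp R V) y -> (#|S| <= t.+1)%N -> 0 <= y S <= 1.
Proof.
move=> ySA; move: {2}#|S| (leqnn #|S|) => n; elim: n S => [|n IH] S Sn St.
  by move: Sn; rewrite leqn0 finset.cards_eq0 => /eqP ->; rewrite (proj1 ySA) ler01 lexx.
have [->|[e eS]] := set_0Vmem S; first by rewrite (proj1 ySA) ler01 lexx.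
have card : #|S| = #|(S :\ e)%SET|.+1 by rewrite (cardsD1 e) eS.
have {}IH := IH (S :\ e)%SET; rewrite -ltnS -card in IH.
have St' : (#|(S :\ e)%SET| <= t)%N by rewrite -ltnS -card.
have /andP[y0 y1] := IH Sn (leqW St').
have SE : (S :\ e :|: [set e])%SET = S by rewrite finset.setUC finset.setD1K.
have in1 : (ind R [set e]%SET, 0) \in balanced_lp R V.
  by rewrite !mem_cat (map_f (fun e => (ind R [set e]%SET, 0))) ?mem_enum // !orbT.
have in2 : (- ind R [set e]%SET, -1) \in balanced_lp R V.
  by rewrite !mem_cat (map_f (fun e => (- ind R [set e]%SET, -1))) ?mem_enum // !orbT.
have := sherali_adams_level0 ySA in1 St'; rewrite mul0r.
rewrite (sum_ind1 (fun i => y (S :\ e :|: [set i])%SET)) SE => ->.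
have := sherali_adams_level0 ySA in2 St'.
under eq_bigr => i _ do rewrite ffunE mulNr.
rewrite sumrN (sum_ind1 (fun i => y (S :\ e :|: [set i])%SET)) SE mulN1r lerN2 => H.
exact: le_trans H y1.
Qed.

(** A continuous cost attains its minimum on a compact set. Coordinates of sets with more than
    [t.+1] elements are unconstrained, so vectors are truncated to 0 there and stay in the unit
    cube. *)
Lemma sa_min_exists (t : nat) (c : V -> V -> R) :
  (exists y, sherali_adams t (balanced_lp R V) y) ->
  exists m, is_min [set sa_cost c y | y in sherali_adams t (balanced_lp R V)] m.
Proof.
move=> [y0 y0SA].
pose set_of (i : 'I_#|{set cedge V}|) : {set cedge V} := enum_val i.
pose trunc (y : {set cedge V} -> R) : vec :=
  \row_i (if (#|set_of i| <= t.+1)%N then y (set_of i) else 0).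
have truncE y (S : {set cedge V}) : (#|S| <= t.+1)%N -> coordinate (trunc y) S = y S.
  by move=> St; rewrite /coordinate mxE /set_of enum_rankK St.
have truncSA y : sherali_adams t (balanced_lp R V) y ->
    sherali_adams t (balanced_lp R V) (coordinate (trunc y)).
  move=> [y1 yS]; split; first by rewrite truncE ?finset.cards0.
  move=> a b ab S Q SQ St; have := yS a b ab S Q SQ St.
  have cT (T : {set cedge V}) : T \subset Q -> (#|S :|: T|%SET <= t)%N.
    move=> /subset_leq_card TQ; apply: leq_trans St.
    by rewrite finset.cardsU (leq_trans (leq_subr _ _)) // leq_add2l.
  have -> : \sum_(T : {set cedge V} | T \subset Q) (-1) ^+ #|T| * coordinate (trunc y) (S :|: T)%SET =
      \sum_(T : {set cedge V} | T \subset Q) (-1) ^+ #|T| * y (S :|: T)%SET.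
    by apply: eq_bigr => T TQ; rewrite truncE // ltnW // ltnS cT.
  congr (_ <= _); apply: eq_bigr => i _; congr (_ * _); apply: eq_bigr => T TQ.
  rewrite truncE // finset.cardsU finset.cards1 (leq_trans (leq_subr _ _)) //.
  by rewrite addn1 ltnS cT.
pose K : set vec := [set v | sherali_adams t (balanced_lp R V) (coordinate v)] `&`
  [set v | forall i, `[0, 1]%classic (v ord0 i)].
have truncK y : sherali_adams t (balanced_lp R V) y -> K (trunc y).
  move=> ySA; split; first exact: truncSA.
  move=> i /=; rewrite in_itv /= mxE; case: ifP => [Si|_]; last by rewrite lexx ler01.
  exact: sherali_adams_range ySA Si.
have Kc : compact K.
  rewrite /K setIC; apply: compact_closedI; last exact: sherali_adams_closed.
  by apply: (@rV_compact R _ (fun=> `[0, 1]%classic)) => i; apply: segment_compact.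
have costE y : sa_cost c (coordinate (trunc y)) = sa_cost c y.
  by apply: eq_bigr => e _; rewrite truncE ?finset.cards1.
have [||v vK vmin] := @EVT_min_rV R _ (fun v => sa_cost c (coordinate v)) K _ Kc.
- by exists (trunc y0); apply: truncK.
- apply: continuous_subspaceT; apply: continuous_lincomb => e; exact: continuous_coordinate.
exists (sa_cost c (coordinate v)); split.
  by exists (coordinate v) => //; move: vK; rewrite inE => -[].
move=> _ [y ySA <-]; rewrite -(costE y); apply: vmin; rewrite inE; exact: truncK.
Qed.

End LPMinimum.

(** * Integrality ratio of a coloured network *)

Section NetworkRatio.
Variables (R : realType) (V A J : finType) (s t : A -> V) (col : A -> J) (w : A -> nat).
Hypothesis st_neq : forall a, s a != t a.
Hypothesis st_inj : forall a b, s a = s b -> t a = t b -> a = b.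
Hypothesis col_bal : forall (j : J) (g : V -> nat),
  (\sum_(a | col a == j) g (s a) = \sum_(a | col a == j) g (t a))%N.
Hypothesis col_conn : forall (j : J) (x : V -> bool),
  (forall a, col a != j -> x (s a) = x (t a)) -> forall u v, x u = x v.
Hypothesis w_gt0 : forall a, (0 < w a)%N.
Hypothesis V_gt1 : (1 < #|V|)%N.

(** The cut at a single vertex already carries weight 1, on edges of cost at least 1. *)
Lemma sa_cost_ge1 level (c : V -> V -> R) y :
  (forall u v, u != v -> 1 <= c u v) ->
  sherali_adams level (balanced_lp R V) y -> 1 <= sa_cost c y.
Proof.
move=> c1 ySA; have /card_gt1P[u [v [_ _ uv]]] := V_gt1.
have in1 : (ind R (din [set u]%SET), 1) \in balanced_lp R V.
  rewrite mem_cat; apply/orP; left; apply: map_f; rewrite mem_filter mem_enum andbT.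
  apply/andP; split; first by apply/set0Pn; exists u; apply: finset.set11.
  apply: contraNneq uv => uT.
  by have := finset.in_setT v; rewrite -uT finset.in_set1 eq_sym.
have := sherali_adams_level0 ySA in1 (S := finset.set0).
rewrite finset.cards0 (proj1 ySA) mulr1 => /(_ isT) H; apply: le_trans H _.
apply: ler_sum => e _; rewrite finset.set0U.
have e1 : (#|[set e]%SET| <= level.+1)%N by rewrite finset.cards1.
have /andP[ye _] := sherali_adams_range ySA e1; apply: ler_wpM2r => //.
by rewrite ffunE; apply: le_trans (c1 _ _ (valP e)); case: (_ \in _); rewrite ?ler01.
Qed.

(** Every tour costs at least [L], while [sa_vector] costs at most $(t+1)/(t+2)$ times the total
    weight, where $t$ is [level]. *)
Lemma network_ratio (j0 : J) (level L : nat) :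
  (forall m, balanced_flow s t m -> connected_flow s t m -> (L <= \sum_a m a * w a)%N) ->
  exists (c : V -> V -> R) (rho : R),
    [/\ is_metric_completion (G := network R w st_neq) c,
        is_integrality_ratio level c rho &
        L%:R * level.+2%:R <= rho * (level.+1%:R * (\sum_a w a)%N%:R)].
Proof.
move=> Lmin.
have cut (U : pred V) : (exists v, U v) -> (exists v, ~~ U v) ->
    exists a, U (s a) && ~~ U (t a).
  by move=> U1 U0; have [a /and3P[_ ? ?]] := col_cut col_bal col_conn j0 U1 U0; exists a; apply/andP.
have [c [cM c1 cw]] := metric_completion_exists R st_neq st_inj w_gt0 cut.
have [||opt optP] := @is_min_uniq_seq R V (@is_ham_dicycle V) (dicycle_cost c).
- by move=> q [/andP[]].
- exact: tour_exists V_gt1.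
have feas := @sa_vector_feasible R V A J s t col st_neq st_inj col_bal col_conn level j0.
have [|lp lpP] := @sa_min_exists R V level c; first by exists (sa_vector R col st_neq level).
have lp1 : 1 <= lp by have [[y ySA <-] _] := lpP; apply: sa_cost_ge1 ySA.
have lp0 : 0 < lp by apply: lt_le_trans lp1.
exists c, (opt / lp); split=> //; first by exists opt, lp.
have optL : L%:R <= opt.
  have [[q qH <-] _] := optP.
  have [m [mb mc ->]] := tour_flow st_inj cM qH.
  by rewrite ler_nat; apply: Lmin.
have lpT : lp * level.+2%:R <= level.+1%:R * (\sum_a w a)%N%:R.
  have [_ lpmin] := lpP; have := lpmin _ (ex_intro2 _ _ _ feas erefl).
  rewrite sa_vector_cost // => lpc.
  have tot : \sum_i c (s i) (t i) <= (\sum_a w a)%N%:R.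
    by rewrite natr_sum; apply: ler_sum => a _; apply: cw.
  have n2 : level.+2%:R != 0 :> R by rewrite pnatr_eq0.
  have pE : (1 - level.+2%:R^-1) * level.+2%:R = level.+1%:R :> R.
    by rewrite mulrBl mulVf // mul1r -[level.+2]addn1 natrD addrK.
  apply: le_trans (ler_wpM2r (ler0n R level.+2) lpc) _.
  by rewrite mulrAC pE ler_wpM2l.
rewrite mulrAC ler_pdivlMr //.
rewrite -mulrA (mulrC _ lp).
by apply: ler_pM => //; rewrite mulr_ge0 ?ler0n // ltW.
Qed.

End NetworkRatio.

(** * The recursive digraph *)

Section CGKGraph.
Local Open Scope nat_scope.
Variable r : nat.

Fixpoint cgkV (k : nat) : finType :=
  if k is k'.+1 then (bool + 'I_r * cgkV k')%type : finType else unit.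

Fixpoint cgkA (k : nat) : finType :=
  if k is k'.+1 then (bool * 'I_r.+1 + 'I_r * cgkA k')%type : finType else void.

(* [cgkT true k] is the source and [cgkT false k] the sink; they coincide for [k = 0]. *)
Definition cgkT (b : bool) (k : nat) : cgkV k :=
  match k with 0 => tt | k'.+1 => inl b end.

(* The [i]-th vertex of the rail that joins the [b]-terminals of the children. *)
Definition station (k : nat) (b : bool) (i : nat) : cgkV k.+1 :=
  if i is j.+1 then
    if insub j is Some l then inr (l, cgkT b k) else inl false
  else inl true.

(* The rail through the sources is directed from the source to the sink, the
   rail through the sinks backwards. *)
Fixpoint tl (k : nat) : cgkA k -> cgkV k :=
  match k return cgkA k -> cgkV k with
  | 0 => fun e => match e with end
  | k'.+1 => fun e => match e with
      | inl (b, i) => if b then station k' true i else station k' false i.+1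
      | inr (l, e') => inr (l, tl e')
      end
  end.

Fixpoint hd (k : nat) : cgkA k -> cgkV k :=
  match k return cgkA k -> cgkV k with
  | 0 => fun e => match e with end
  | k'.+1 => fun e => match e with
      | inl (b, i) => if b then station k' true i.+1 else station k' false i
      | inr (l, e') => inr (l, hd e')
      end
  end.

Fixpoint wt (k : nat) : cgkA k -> nat :=
  match k return cgkA k -> nat with
  | 0 => fun e => match e with end
  | k'.+1 => fun e => match e with
      | inl _ => r.+1 ^ k'
      | inr (l, e') => wt e'
      end
  end.

Lemma sum_cgkA k (F : cgkA k.+1 -> nat) (P : pred (cgkA k.+1)) :
  \sum_(e | P e) F e =
  \sum_(i < r.+1 | P (inl (true, i))) F (inl (true, i)) +
  \sum_(i < r.+1 | P (inl (false, i))) F (inl (false, i)) +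
  \sum_(l < r) \sum_(e | P (inr (l, e))) F (inr (l, e)).
Proof.
rewrite big_sumType /=; congr (_ + _).
  transitivity (\sum_(p | true && P (inl (p.1, p.2))) F (inl (p.1, p.2))).
    by apply: eq_big => -[].
  rewrite -(pair_big_dep xpredT (fun b i => P (inl (b, i)))
             (fun b i => F (inl (b, i)))) /=.
  by rewrite big_bool.
transitivity (\sum_(p | true && P (inr (p.1, p.2))) F (inr (p.1, p.2))).
  by apply: eq_big => -[].
by rewrite -(pair_big_dep xpredT (fun l e => P (inr (l, e)))
             (fun l e => F (inr (l, e)))).
Qed.

(** The position along the rails; a child occupies one slot as a whole. It tells stations apart and
    serves to contract children in test functions. *)
Definition slot k (v : cgkV k.+1) : nat :=
  match v with inl b => if b then 0 else r.+1 | inr (l, _) => l.+1 end.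

Lemma slot_station k b i : i <= r.+1 -> slot (station k b i) = i.
Proof.
case: i => [|i] //= ir; case: insubP => [l _ <-//|].
by rewrite -leqNgt => ri; apply/eqP; rewrite eqn_leq !ltnS ri -ltnS ir.
Qed.

#[global] Arguments station : simpl never.

Lemma tl_neq_hd k (e : cgkA k) : tl e != hd e.
Proof.
elim: k e => [|k IH] /=; first by case.
case=> [[b i]|[l e]] /=; last by apply: contraNneq (IH e) => -[->].
apply/eqP => /(congr1 (@slot k)).
by have := ltn_ord i; case: b => /= ir; rewrite !slot_station; lia.
Qed.

Lemma tl_hd_inj k (e f : cgkA k) : tl e = tl f -> hd e = hd f -> e = f.
Proof.
elim: k e f => [|k IH] /=; first by case.
case=> [[b i]|[l e]] [[c j]|[l' f]] /= tlE hdE.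
- move: (congr1 (@slot k) tlE) (congr1 (@slot k) hdE) (ltn_ord i) (ltn_ord j).
  case: b c {tlE hdE} => -[] /= + + ir jr; rewrite !slot_station; try lia;
    by move=> *; congr (inl (_, _)); apply: val_inj => /=; lia.
- move: (congr1 (@slot k) tlE) (congr1 (@slot k) hdE) (ltn_ord i).
  by case: b {tlE hdE} => /= + + ir; rewrite !slot_station; lia.
- move: (congr1 (@slot k) tlE) (congr1 (@slot k) hdE) (ltn_ord j).
  by case: c {tlE hdE} => /= + + jr; rewrite !slot_station; lia.
- by case: tlE hdE => <- tlE [hdE]; rewrite (IH e f).
Qed.

Lemma card_cgkV k : #|cgkV k| <= r.+2 ^ k.
Proof.
elim: k => [|k IH]; first by rewrite card_unit.
rewrite card_sum card_bool card_prod card_ord expnS !mulSn addnA leq_add ?leq_mul //.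
by have := expn_gt0 r.+2 k; lia.
Qed.

Lemma wt_gt0 k (e : cgkA k) : 0 < wt e.
Proof. by elim: k e => [|k IH] //= [_|[l e]] //; rewrite expn_gt0. Qed.

(** * Lower bound on the cost of circulations *)

Definition circulation k (m : cgkA k -> nat) := forall g : cgkV k -> nat,
  g (cgkT true k) = 0 -> g (cgkT false k) = 0 ->
  \sum_e m e * g (tl e) = \sum_e m e * g (hd e).

(** Like [circulation], this says nothing about the terminals, where the rails of the parent attach;
    hence both conditions pass to the children. *)
Definition leaves_inner_sets k (m : cgkA k -> nat) := forall U : pred (cgkV k),
  ~~ U (cgkT true k) -> ~~ U (cgkT false k) -> (exists v, U v) ->
  exists e, [&& U (tl e), ~~ U (hd e) & 0 < m e].

Definition child k (m : cgkA k.+1 -> nat) (l : 'I_r) (e : cgkA k) : nat :=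
  m (inr (l, e)).

(** Non-zero net flow through the copy, read off at its source; a single vertex counts as
    balanced. *)
Definition unbalanced k : (cgkA k -> nat) -> bool :=
  match k return (cgkA k -> nat) -> bool with
  | 0 => fun _ => false
  | _.+1 => fun m => m (inl (true, ord0)) != m (inl (false, ord0))
  end.

Lemma station_in k b (l : 'I_r) : station k b l.+1 = inr (l, cgkT b k).
Proof. by rewrite /station valK. Qed.

Lemma station_last k b : station k b r.+1 = inl false.
Proof. by rewrite /station insubN // ltnn. Qed.

Lemma sum_delta (F : nat -> nat) n p : p < n -> \sum_(i < n) F i * (i == p :> nat) = F p.
Proof.
move=> pn; rewrite (bigD1 (Ordinal pn)) //= eqxx muln1 big1 ?addn0 // => i.
by rewrite -val_eqE /= => /negPf ->; rewrite muln0.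
Qed.

Section Circulation.
Variables (k : nat) (m : cgkA k.+1 -> nat).
Hypothesis mC : circulation m.
Let a i := m (inl (true, inord i)).
Let b i := m (inl (false, inord i)).

Lemma sum_tl (g : cgkV k.+1 -> nat) :
  \sum_e m e * g (tl e) =
  \sum_(i < r.+1) a i * g (station k true i) +
  \sum_(i < r.+1) b i * g (station k false i.+1) +
  \sum_(l < r) \sum_e child m l e * g (inr (l, tl e)).
Proof.
by rewrite sum_cgkA; congr (_ + _ + _); apply: eq_bigr => i _; rewrite ?/a ?/b ?inord_val.
Qed.

Lemma sum_hd (g : cgkV k.+1 -> nat) :
  \sum_e m e * g (hd e) =
  \sum_(i < r.+1) a i * g (station k true i.+1) +
  \sum_(i < r.+1) b i * g (station k false i) +
  \sum_(l < r) \sum_e child m l e * g (inr (l, hd e)).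
Proof.
by rewrite sum_cgkA; congr (_ + _ + _); apply: eq_bigr => i _; rewrite ?/a ?/b ?inord_val.
Qed.

Lemma child_circulation l : circulation (child m l).
Proof.
move=> g g1 g0.
pose h (v : cgkV k.+1) :=
  if v is inr (l', v') then if l' == l then g v' else 0 else 0.
have hS c i : h (station k c i) = 0.
  case: i => [|i] //; rewrite /station; case: insubP => [l' _ _|//] /=.
  by case: eqP => // _; case: c.
have := mC (g := h) erefl erefl.
rewrite sum_tl sum_hd ![\sum_(i < r.+1) _]big1; do ?by move=> i _; rewrite hS muln0.
rewrite !add0n (bigD1 l) //= [RHS](bigD1 l) //= eqxx.
by rewrite ![\sum_(i < r | _) _]big1 ?addn0 // => l' /negPf ->;
  rewrite big1 // => e _; rewrite muln0.
Qed.

Lemma child_leaves l : leaves_inner_sets m -> leaves_inner_sets (child m l).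
Proof.
move=> mU U U1 U0 [v Uv].
pose W (v : cgkV k.+1) := if v is inr (l', v') then (l' == l) && U v' else false.
have WS c i : ~~ W (station k c i).
  case: i => [|i] //; rewrite /station; case: insubP => [l' _ _|//] /=.
  by case: c; rewrite negb_and ?U1 ?U0 orbT.
have W1 : ~~ W (cgkT true k.+1) by [].
have W0 : ~~ W (cgkT false k.+1) by [].
have [|e /and3P[We hWe me]] := mU W W1 W0; first by exists (inr (l, v)); rewrite /= eqxx.
case: e We hWe me => [[[] i]|[l' e]]; try by rewrite /= (negPf (WS _ _)).
move=> /= /andP[/eqP-> Ue]; rewrite eqxx /= => He me; exists e; exact/and3P.
Qed.

(** Conservation with child [l] contracted to a vertex; hence the difference of [a] and [b] is
    constant along the rails. *)
Lemma rail_balance (l : 'I_r) : a l + b l.+1 = a l.+1 + b l.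
Proof.
pose g (v : cgkV k.+1) : nat := slot v == l.+1.
have rl : (r == l) = false by apply: gtn_eqF.
have gF : g (cgkT false k.+1) = 0 by rewrite /g /= eqSS rl.
have := mC (g := g) erefl gF; rewrite sum_tl sum_hd /g /=.
have eqS c f F : (forall i, i <= r -> f i <= r.+1) ->
    \sum_(i < r.+1) F i * (slot (station k c (f i)) == l.+1) =
    \sum_(i < r.+1) F i * (f i == l.+1).
  by move=> fr; apply: eq_bigr => i _; rewrite slot_station // fr // -ltnS.
rewrite (eqS _ id) ?(eqS _ succn) //; do ?by move=> i; lia.
rewrite (eqS _ id) ?(eqS _ succn) //; do ?by move=> i; lia.
have ll := ltn_ord l.
by rewrite !(sum_delta a, sum_delta b) //; lia.
Qed.

Lemma rail_zero_inj i j : leaves_inner_sets m -> ~~ unbalanced m ->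
  i <= r -> j <= r -> a i = 0 -> a j = 0 -> i = j.
Proof.
move=> mU /negPn /eqP ab0.
have ab p : p <= r -> a p = b p.
  elim: p => [_|p IH pr]; first by rewrite /a /b (_ : inord 0 = ord0) //; apply: val_inj; rewrite /= inordK.
  by have := rail_balance (Ordinal pr); have := IH (ltnW pr); rewrite /=; lia.
wlog ij : i j / i < j => [H ir jr ai aj|].
  by case: (ltngtP i j) => // ?; [apply: H|apply/esym/H].
move=> ir jr ai aj.
pose U (v : cgkV k.+1) := i < slot v <= j.
have UT : ~~ U (cgkT true k.+1) by [].
have UF : ~~ U (cgkT false k.+1) by rewrite /U /=; lia.
have [|e] := mU U UT UF.
  by exists (station k true i.+1); rewrite /U slot_station; lia.
case: e => [[c p]|[l e]] /and3P[]; rewrite /U /=; last by move->.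
have := ltn_ord p; case: c => /= pr; rewrite !slot_station //; try lia; move=> p1 p2.
  have -> : p = inord j by apply: val_inj; rewrite /= inordK //; lia.
  by rewrite -/(a j) aj.
have -> : p = inord i by apply: val_inj; rewrite /= inordK //; lia.
by rewrite -/(b i) -ab // ai.
Qed.

Lemma sum_mulwt :
  \sum_e m e * wt e = r.+1 ^ k * \sum_(i < r.+1) (a i + b i) +
    \sum_(l < r) \sum_e child m l e * wt e.
Proof.
rewrite sum_cgkA; congr (_ + _).
rewrite big_distrr -big_split; apply: eq_bigr => i _ /=.
by rewrite /a /b inord_val mulnDr !(mulnC (r.+1 ^ k)).
Qed.

End Circulation.

Lemma station_eq k b c i (l : 'I_r) : i <= r.+1 ->
  (station k.+1 b i == inr (l, cgkT c k.+1)) = (b == c) && (i == l.+1).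
Proof.
move=> ir; have [->|il] := eqVneq i l.+1.
  rewrite station_in andbT; apply/eqP/eqP => [[]//|->//].
by rewrite andbF; apply: contra_neqF il => /eqP/(congr1 (@slot _)); rewrite slot_station.
Qed.

Lemma station_eq_src k b i : i <= r.+1 -> (station k b i == inl true) = (i == 0).
Proof.
case: i => [|i] ir //; apply/eqP => /(congr1 (@slot k)); rewrite slot_station //.
Qed.

(** Conservation at the source of child [l]: what enters the child there, net, is what the forward
    rail loses. The child has level [k.+1], so its source and sink differ. *)
Lemma unbalanced_child k (m : cgkA k.+2 -> nat) (l : 'I_r) : circulation m ->
  unbalanced (child m l) ->
  m (inl (true, inord l)) != m (inl (true, inord l.+1)).
Proof.
move=> mC /=; apply: contraNneq => aE.
pose g (v : cgkV k.+2) : nat := v == inr (l, cgkT true k.+1).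
have railT f p : (forall i, (f i == l.+1) = (i == p)) -> (forall i, i <= r -> f i <= r.+1) ->
    p <= r -> \sum_(i < r.+1) m (inl (true, inord i)) * g (station k.+1 true (f i)) =
      m (inl (true, inord p)).
  move=> fE fr pr; rewrite -(sum_delta (fun i => m (inl (true, inord i))) (n := r.+1)) //.
  by apply: eq_bigr => i _; rewrite /g station_eq ?fE // fr // -ltnS.
have railF f : (forall i, i <= r -> f i <= r.+1) ->
    \sum_(i < r.+1) m (inl (false, inord i)) * g (station k.+1 false (f i)) = 0.
  by move=> fr; rewrite big1 // => i _; rewrite /g station_eq ?muln0 // fr // -ltnS.
pose g' (v : cgkV k.+1) : nat := v == cgkT true k.+1.
have gE j v : g (inr (j, v)) = (j == l) && (v == cgkT true k.+1).
  by rewrite /g; congr nat_of_bool; apply/eqP/andP => [[-> ->]|[/eqP-> /eqP->]].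
have sub h : \sum_(j < r) \sum_e child m j e * g (inr (j, h e)) =
    \sum_e child m l e * g' (h e).
  rewrite (bigD1 l) //= [X in _ + X]big1 ?addn0 => [|j jl].
    by apply: eq_bigr => e _; rewrite gE eqxx.
  by rewrite big1 // => e _; rewrite gE (negPf jl) muln0.
have := mC g erefl erefl; rewrite sum_tl sum_hd !sub.
have ll := ltn_ord l.
rewrite (railT id l.+1) ?(railT succn l) ?(railF id) ?(railF succn) //; try by [lia|move=> i; lia].
rewrite sum_tl sum_hd /=.
have rail0 b c : \sum_(i < r.+1) child m l (inl (c, inord i)) * g' (station k b i) =
    child m l (inl (c, ord0)).
  rewrite big_ord_recl /= (_ : inord 0 = ord0); last by apply: val_inj; rewrite /= inordK.
  rewrite {1}/g' eqxx muln1 big1 ?addn0 // => i _.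
  by rewrite /g' station_eq_src ?muln0 //; apply/ltnW/ltn_ord.
have rail0S b c :
    \sum_(i < r.+1) child m l (inl (c, inord i)) * g' (station k b i.+1) = 0.
  by rewrite big1 // => i _; rewrite /g' station_eq_src ?muln0.
have inner h : \sum_(j < r) \sum_e child (child m l) j e * g' (inr (j, h e)) = 0.
  by rewrite big1 // => j _; rewrite big1 // => e _; rewrite muln0.
by rewrite !rail0 !rail0S !inner !addn0 aE => /addnI ->.
Qed.

(** The difference $a-b$ is constant. If it is 0, each change of $a$ touches a position with
    $a\ne1$, and $2a\ge2+2[a\ne1]-4[a=0]$ with at most one zero. Otherwise $a+b\ge1$ everywhere, and
    each change touches a position where both rails are used, so that $a+b\ge3$. *)
Lemma rail_cost (a b : nat -> nat) : 0 < r ->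
  (forall l, l < r -> a l + b l.+1 = a l.+1 + b l) ->
  (a 0 = b 0 -> forall i j, i <= r -> j <= r -> a i = 0 -> a j = 0 -> i = j) ->
  2 * r.-1 + \sum_(l < r) (a l != a l.+1) <=
    \sum_(i < r.+1) (a i + b i) + r.+1 * (a 0 != b 0).
Proof.
move=> r0 bal inj.
have var h : (forall l, l < r -> (a l != a l.+1) <= h l + h l.+1) ->
    \sum_(l < r) (a l != a l.+1) <= 2 * \sum_(i < r.+1) h i.
  move=> H; apply: (@leq_trans (\sum_(l < r) (h l + h l.+1))).
    by apply: leq_sum => l _; apply: H.
  rewrite big_split mul2n -addnn leq_add //.
    by rewrite big_ord_recr leq_addr.
  by rewrite [leqRHS]big_ord_recl leq_addl.
case: (eqVneq (a 0) (b 0)) => [ab0|ab0] /=; rewrite ?muln0 ?muln1 ?addn0.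
  have ab i : i <= r -> a i = b i.
    by elim: i => // i IH ir; have := bal _ ir; have := IH (ltnW ir); lia.
  have zero : \sum_(i < r.+1) (a i == 0) <= 1.
    have [/existsP[i /eqP ai]|/existsPn no] := boolP [exists i : 'I_r.+1, a i == 0].
      rewrite (bigD1 i) //= ai eqxx big1 // => j ji; apply/eqP; rewrite eqb0.
      apply: contraNneq ji => aj; exact/eqP/val_inj/(inj ab0 _ _ (ltn_ord j) (ltn_ord i) aj ai).
    by rewrite big1 // => i _; rewrite (negPf (no i)).
  have : \sum_(l < r) (a l != a l.+1) <= 2 * \sum_(i < r.+1) (a i != 1).
    by apply: (var (fun i => (a i != 1) : nat)) => l _; lia.
  have : \sum_(i < r.+1) (2 + 2 * (a i != 1)) <=
      \sum_(i < r.+1) ((a i + b i) + 4 * (a i == 0)).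
    by apply: leq_sum => i _; have := ab i (ltn_ord i); lia.
  rewrite !big_split /= !sum_nat_const card_ord. move: zero.
  move: (\sum_(i < r.+1) (a i == 0)) (\sum_(i < r.+1) (a i != 1)) (\sum_(i < r.+1) a i).
  move: (\sum_(i < r.+1) b i) (\sum_(l < r) (a l != a l.+1)).
  by move=> *; lia.
have abn i : i <= r -> a i + b 0 = a 0 + b i.
  elim: i => [_|i IH ir]; first by rewrite addnC.
  by have := bal _ ir; have := IH (ltnW ir); lia.
have H : \sum_(l < r) (a l != a l.+1) <= 2 * \sum_(i < r.+1) ((0 < a i) && (0 < b i)).
  apply: (var (fun i => ((0 < a i) && (0 < b i)) : nat)) => l lr.
  by have := abn l (ltnW lr); have := abn l.+1 lr; lia.
have : \sum_(i < r.+1) (1 + 2 * ((0 < a i) && (0 < b i))) <= \sum_(i < r.+1) (a i + b i).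
  by apply: leq_sum => i _; have := abn i (ltn_ord i); lia.
rewrite !big_split /= !sum_nat_const card_ord; move: H.
move: (\sum_(i < r.+1) ((0 < a i) && (0 < b i))) (\sum_(i < r.+1) a i).
move: (\sum_(i < r.+1) b i) (\sum_(l < r) (a l != a l.+1)).
by move=> *; lia.
Qed.

Fixpoint tour_bound k :=
  if k is k'.+1 then r * tour_bound k' + 2 * r.-1 * r.+1 ^ k' else 0.

(** An unbalanced child may fall short of its bound by $(r+1)^k$. It forces a change of rail flow,
    and [rail_cost] yields that much excess per change, so only the deficit of the outermost copy
    remains. *)
Lemma circulation_cost k (m : cgkA k -> nat) : 0 < r ->
  circulation m -> leaves_inner_sets m ->
  tour_bound k <= \sum_e m e * wt e + r.+1 ^ k * unbalanced m.
Proof.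
move=> r0; elim: k m => [|k IH] m mC mU //=.
have ub (l : 'I_r) : unbalanced (child m l) <=
    (m (inl (true, inord l)) != m (inl (true, inord l.+1))).
  case: k m mC {IH mU} => [|k] m mC //.
  by have := unbalanced_child (l := l) mC; case: unbalanced => // ->.
pose a i := m (inl (true, inord i)).
pose b i := m (inl (false, inord i)).
have inord0 : inord 0 = ord0 :> 'I_r.+1 by apply: val_inj; rewrite /= inordK.
have := @rail_cost a b r0.
have bal l : l < r -> a l + b l.+1 = a l.+1 + b l.
  by move=> lr; apply: (rail_balance mC (Ordinal lr)).
move=> /(_ bal) H; have /H : a 0 = b 0 ->
    forall i j, i <= r -> j <= r -> a i = 0 -> a j = 0 -> i = j.
  by rewrite /a /b inord0 => ab0 i j; apply: rail_zero_inj => //=; rewrite negbK; apply/eqP.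
move=> {}H; rewrite sum_mulwt.
have {}IH : \sum_(l < r) tour_bound k <=
    \sum_(l < r) (\sum_e child m l e * wt e + r.+1 ^ k * (a l != a l.+1)).
  apply: leq_sum => l _.
  apply: leq_trans (IH _ (@child_circulation _ _ mC l) (@child_leaves _ _ l mU)) _.
  by rewrite leq_add2l leq_mul2l; apply/orP; right.
move: IH; rewrite big_split /= -big_distrr /= sum_nat_const card_ord.
have -> : m (inl (true, ord0)) = a 0 by rewrite /a inord0.
have -> : m (inl (false, ord0)) = b 0 by rewrite /b inord0.
rewrite expnS; move: (r.+1 ^ k) (tour_bound k) H => P B.
move: (\sum_(l < r) (a l != a l.+1)) (\sum_(i < r.+1) (a i + b i)).
move: (\sum_(l < r) \sum_e child m l e * wt e) => X Y Z H IH.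
move: (nat_of_bool _) H => c /(leq_mul (leqnn P)); lia.
Qed.

(** * The cells: balance, and connectivity after deleting one *)

Fixpoint cgkC (k : nat) : finType :=
  match k with
  | k'.+2 => ('I_r.+1 + 'I_r * 'I_r * cgkC k')%type : finType
  | _ => unit
  end.

(* The cell [c] of a copy of [cgkV k.+2] consists of the two rail arcs between its children
   [c - 1] and [c] and of the rails of these children that close them to a dicycle. A copy thus
   uses up the rails of its children as well, whence the recursion in steps of two; the value at
   [k = 1] is junk. *)
Fixpoint col (k : nat) : cgkA k -> cgkC k :=
  match k return cgkA k -> cgkC k with
  | 0 => fun _ => tt
  | 1 => fun _ => tt
  | k'.+2 => fun e => match e with
      | inl (_, i) => inl i
      | inr (l, inl (b, _)) => inl (if b then inord l else inord l.+1)
      | inr (l, inr (l', e')) => inr (l, l', col e')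
      end
  end.

Lemma sum_shift (f : nat -> nat) n : \sum_(i < n) f i + f n = \sum_(i < n) f i.+1 + f 0.
Proof.
elim: n => [|n IH]; first by rewrite !big_ord0.
by rewrite !big_ord_recr /= IH addnAC.
Qed.

Lemma sum_const_cond (I : finType) (P : pred I) (b : bool) (F : I -> nat) :
  P =1 (fun=> b) -> \sum_(i | P i) F i = b * \sum_i F i.
Proof.
by move=> Pb; rewrite (eq_bigl _ _ Pb); case: b {Pb}; rewrite ?mul1n ?big_pred0_eq.
Qed.

Definition col_balanced k := forall (j : cgkC k) (g : cgkV k -> nat),
  \sum_(e | col e == j) g (tl e) = \sum_(e | col e == j) g (hd e).

(** Cell [c] of the top level is a dicycle: the forward rail arc to the source of child [c], that
    child's forward rail, the rail arc back to the sink of child [c - 1], and that child's backward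
    rail. *)
Lemma col_balanced_step k : col_balanced k -> col_balanced k.+2.
Proof.
move=> IH j g.
rewrite !sum_cgkA.
case: j => [c|[[l0 l0'] j]]; last first.
  rewrite ![\sum_(i < r.+1 | _) _]big_pred0 // !add0n; apply: eq_bigr => l _.
  rewrite !sum_cgkA ![\sum_(i < r.+1 | _) _]big_pred0 // !add0n; apply: eq_bigr => l' _ /=.
  have cE e : (inr (l, l', col e) == inr (l0, l0', j) :> cgkC k.+2) =
      ((l, l') == (l0, l0')) && (col e == j).
    by apply/eqP/andP => [[-> -> ->]|[/eqP[-> ->] /eqP->]].
  rewrite (eq_bigl _ _ cE) [RHS](eq_bigl _ _ cE).
  case: eqP => _ /=; last by rewrite !big_pred0_eq.
  exact: (IH j (fun v => g (inr (l, inr (l', v))))).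
pose G b i := g (station k.+1 b i).
pose S b l := \sum_(i < r.+1) g (inr (l, station k b i)).
pose S' b l := \sum_(i < r.+1) g (inr (l, station k b i.+1)).
(* Telescoping along a rail of child [l] leaves only the child's two terminals. *)
have SG b l : S b l + G false l.+1 = S' b l + G true l.+1.
  have := sum_shift (fun i => g (inr (l, station k b i))) r.+1.
  by rewrite /G !station_in station_last.
have railE b (F : 'I_r.+1 -> nat) :
    \sum_(i < r.+1 | col (inl (b, i) : cgkA k.+2) == inl c) F i = F c.
  by apply: big_pred1 => i; apply/eqP/eqP => [[]|->].
have childE (l : 'I_r) (h : cgkA k.+1 -> cgkV k.+1) :
    \sum_(e | col (inr (l, e) : cgkA k.+2) == inl c) g (inr (l, h e)) =
    (l == c :> nat) * \sum_(i < r.+1) g (inr (l, h (inl (true, i)))) +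
    (l.+1 == c :> nat) * \sum_(i < r.+1) g (inr (l, h (inl (false, i)))).
  have inlE (p : nat) : p <= r -> (inl (inord p) == inl c :> cgkC k.+2) = (p == c).
    by move=> pr; apply/eqP/eqP => [[<-]|->]; rewrite ?inordK ?inord_val.
  rewrite sum_cgkA [X in _ + X]big1 => [|l' _]; last by rewrite big_pred0.
  by rewrite addn0; congr (_ + _); apply: sum_const_cond => i; apply: inlE;
    have := ltn_ord l; lia.
rewrite !railE !(eq_bigr _ (fun l _ => childE l _)) /=.
rewrite -!/(G _ _).
have cell b : \sum_(l < r) (l == c :> nat) * G b l.+1 = (c < r) * G b c.+1.
  case: ltnP => cr; rewrite ?mul1n.
    rewrite -(sum_delta (fun i => G b i.+1) cr); apply: eq_bigr => l _; exact: mulnC.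
  by rewrite big1 // => l _; rewrite ltn_eqF ?(leq_trans _ cr).
have cell' b : \sum_(l < r) (l.+1 == c :> nat) * G b l.+1 = (0 < c) * G b c.
  case: (nat_of_ord c) (ltn_ord c) => [|p] pr; first by rewrite big1.
  rewrite mul1n -(sum_delta (fun i => G b i.+1) (pr : p < r)); apply: eq_bigr => l _; exact: mulnC.
have : \sum_(l < r) ((l == c :> nat) * S true l + (l.+1 == c :> nat) * S' false l) +
    (\sum_(l < r) (l == c :> nat) * G false l.+1 + \sum_(l < r) (l.+1 == c :> nat) * G true l.+1) =
   \sum_(l < r) ((l == c :> nat) * S' true l + (l.+1 == c :> nat) * S false l) +
    (\sum_(l < r) (l == c :> nat) * G true l.+1 + \sum_(l < r) (l.+1 == c :> nat) * G false l.+1).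
  rewrite -!big_split /=; apply: eq_bigr => l _.
  have := SG true l; have := SG false l.
  by case: eqP => _; case: eqP => _; rewrite ?mul1n ?mul0n; lia.
rewrite !cell !cell' /S /S'.
(* The first and last cells lack a child on one side; there the two rails meet in a terminal. *)
have G0 : G true 0 = G false 0 by [].
have Gr : G true r.+1 = G false r.+1 by rewrite /G !station_last.
move: (\sum_(l < r) _) => X; move: (\sum_(l < r) _) => Y.
have cr : c <= r by have := ltn_ord c.
move: (nat_of_ord c) cr => p pr; case: (ltngtP p r) pr => // [pr|->] _.
  by case: p pr => [|p] pr; rewrite ?mul1n ?mul0n ?G0; lia.
by rewrite Gr; case: r => [|q]; rewrite ?mul1n ?mul0n ?G0; lia.
Qed.

Lemma col_balanced_double n : col_balanced n.*2.
Proof.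
by elim: n => [|n IH]; [move=> j g; rewrite !big_pred0 // => -[]|apply: col_balanced_step].
Qed.

Lemma path_const (T : Type) (f : nat -> T) p q : p <= q ->
  (forall i, p <= i < q -> f i = f i.+1) -> f p = f q.
Proof.
move=> pq; rewrite -(subnK pq); elim: (q - p) => [|d IH] // H.
by rewrite IH => [|i iq]; rewrite ?addSn; apply: H; lia.
Qed.

Section Connectivity.
Variable T : Type.

Lemma connected k (x : cgkV k -> T) : (forall e, x (tl e) = x (hd e)) ->
  forall b v, x v = x (cgkT b k).
Proof.
elim: k x => [|k IH] x xE b v; first by case: v.
have S b' i : i <= r.+1 -> x (station k b' i) = x (inl true).
  move=> ir; symmetry; apply: (@path_const _ (fun i => x (station k b' i)) 0 i) => // p pi.
  have pr : p < r.+1 by lia.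
  by have := xE (inl (b', Ordinal pr)); case: b'.
have xT b' : x (inl b') = x (inl true).
  by case: b' => //; rewrite -(S true r.+1) // station_last.
rewrite [RHS]xT; case: v => [b'|[l v]]; first exact: xT.
rewrite (IH (fun v => x (inr (l, v))) _ true) => [|e].
  by rewrite -(S true l.+1) ?station_in // ltnW // ltnS.
exact: (xE (inr (l, e))).
Qed.

(** Connectivity is undirected, which balance makes sufficient. Deleting a cell of the top level
    separates source from sink, hence the disjunction. *)
Definition connected_without_colour k := forall (j : cgkC k) (x : cgkV k -> T),
  (forall e, col e != j -> x (tl e) = x (hd e)) ->
  forall v, x v = x (cgkT true k) \/ x v = x (cgkT false k).

(** Without the top cell [c], the children before [c] hang on the source and the others on the sink,
    each keeping one of its rails. Without a cell inside a grandchild, all rails survive and tie the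
    terminals of that grandchild together. *)
Lemma connected_without_colour_step k :
  connected_without_colour k -> connected_without_colour k.+2.
Proof.
move=> IH j x xE.
have rail b p q : p <= q <= r.+1 ->
    (forall i : 'I_r.+1, p <= i < q -> inl i != j :> cgkC k.+2) ->
    x (station k.+1 b p) = x (station k.+1 b q).
  move=> /andP[pq qr] H; apply: (@path_const _ (fun i => x (station _ b i)) p q) => // i iq.
  have ir : i < r.+1 by lia.
  by have := xE (inl (b, Ordinal ir)) (H (Ordinal ir) iq); case: b {H}.
have rail' (l : 'I_r) b : (inl (if b then inord l else inord l.+1) != j :> cgkC k.+2) ->
    forall i, i <= r.+1 -> x (inr (l, station k b i)) = x (inr (l, cgkT true k.+1)).
  move=> lj i ir; symmetry.
  apply: (@path_const _ (fun i => x (inr (l, station k b i))) 0 i) => // p pi.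
  have pr : p < r.+1 by lia.
  by have := xE (inr (l, inl (b, Ordinal pr))) lj; case: b {lj}.
have grandchild (l l' : 'I_r) : (forall e : cgkA k, inr (l, l', col e) != j :> cgkC k.+2) ->
    forall b v, x (inr (l, inr (l', v))) = x (inr (l, inr (l', cgkT b k))).
  move=> lj; apply: (connected (x := fun v => x (inr (l, inr (l', v))))) => e.
  exact: (xE (inr (l, inr (l', e))) (lj e)).
case: j => [c|[[l0 l0'] j]] in xE rail rail' grandchild *.
  have cE b (l : 'I_r) v : x (inr (l, v)) = x (inr (l, cgkT b k.+1)).
    (* [d] selects a rail of child [l] that survives: the forward rail has colour [l], the backward
       one [l.+1]. *)
    pose d := l != c :> nat.
    have dj : inl (if d then inord l else inord l.+1) != inl c :> cgkC k.+2.
      apply/eqP => -[/(congr1 val)]; rewrite /d; have := ltn_ord l.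
      by case: eqP => /= lc lr; rewrite inordK; lia.
    have H := rail' l d dj.
    have V w : x (inr (l, w)) = x (inr (l, cgkT true k.+1)).
      case: w => [[]|[l' w]] //; first by rewrite -(H r.+1) // station_last.
      rewrite (grandchild l l' _ d) //.
      by rewrite -(H l'.+1) ?station_in // ltnW // ltnS.
    by rewrite (V v) -(V (cgkT b k.+1)).
  case=> [[]|[l v]]; [by left|by right|].
  rewrite (cE true) -station_in; have [lc|lc] := ltnP l c.
    left; rewrite -(rail true 0 l.+1) //; first by have := ltn_ord l; lia.
    by move=> i il; apply/eqP => -[ic]; move: il; rewrite ic; lia.
  right; rewrite (rail true l.+1 r.+1) ?station_last //; first by have := ltn_ord l; lia.
  by move=> i il; apply/eqP => -[ic]; move: il; rewrite ic; lia.
have S b i : i <= r.+1 -> x (station k.+1 b i) = x (inl true).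
  by move=> ir; rewrite -(rail b 0 i).
have xT b : x (inl b) = x (inl true).
  by case: b => //; rewrite -(S true r.+1) // station_last.
have S' l b i : i <= r.+1 -> x (inr (l, station k b i)) = x (inl true).
  by move=> ir; rewrite rail' // -station_in S // ltnW // ltnS.
move=> v; left; case: v => [b|[l [b|[l' v]]]]; first exact: xT.
  by rewrite -(S b l.+1) ?station_in // ltnW // ltnS.
have xT' b : x (inr (l, inr (l', cgkT b k))) = x (inl true).
  by rewrite -station_in S' // ltnW // ltnS.
have [e0|e0] := eqVneq (l, l') (l0, l0').
  have W e : col e != j -> x (inr (l, inr (l', tl e))) = x (inr (l, inr (l', hd e))).
    move=> ej; have eJ : col (inr (l, inr (l', e)) : cgkA k.+2) != inr (l0, l0', j).
      by apply: contraNneq ej => -[_ _ ->].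
    exact: xE eJ.
  by case: (IH j (fun v => x (inr (l, inr (l', v)))) W v) => ->; rewrite xT'.
rewrite (grandchild l l' _ true) ?xT' // => e.
by apply: contraNneq e0 => -[-> -> _].
Qed.

Lemma connected_without_colour_double n : connected_without_colour n.*2.
Proof.
by elim: n => [|n IH]; [move=> j x _ [] /=; left|apply: connected_without_colour_step].
Qed.

End Connectivity.

End CGKGraph.

(** * Closing the digraph between source and sink *)

Section ClosedGraph.
Local Open Scope nat_scope.
Variables (r k : nat).
Hypothesis r_gt0 : 0 < r.
Hypothesis k_gt0 : 0 < k.

(** Two opposite arcs of cost 1 between the terminals form one more cell; they reconnect source and
    sink when a top cell is deleted. *)
Definition closedA : finType := (bool + cgkA r k)%type.
Definition closed_tl (a : closedA) : cgkV r k :=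
  match a with inl b => cgkT r b k | inr e => tl e end.
Definition closed_hd (a : closedA) : cgkV r k :=
  match a with inl b => cgkT r (~~ b) k | inr e => hd e end.
Definition closed_wt (a : closedA) : nat := if a is inr e then wt e else 1.
Definition closed_col (a : closedA) : unit + cgkC r k :=
  match a with inl _ => inl tt | inr e => inr (col e) end.

Lemma closed_neq a : closed_tl a != closed_hd a.
Proof.
case: a => [b|e] /=; last exact: tl_neq_hd.
by move: k_gt0; case: k => //; case: b.
Qed.

Lemma terminal_arc b (e : cgkA r k) : tl e = cgkT r b k -> hd e = cgkT r (~~ b) k -> False.
Proof.
case: k e => [|k'] //= [[c i]|[l e]] /(congr1 (@slot r k')) + /(congr1 (@slot r k')).
  by have := ltn_ord i; case: b c => -[] ir /=; rewrite !slot_station /=; lia.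
by have := ltn_ord l; case: b => /=; lia.
Qed.

Lemma closed_inj a b : closed_tl a = closed_tl b -> closed_hd a = closed_hd b -> a = b.
Proof.
case: a b => [a|a] [b|b] /=.
- by move: k_gt0; case: k => // k' _; case: a b => -[].
- by move=> /esym H1 /esym H2; case: (terminal_arc H1 H2).
- by move=> H1 H2; case: (terminal_arc H1 H2).
- by move=> H1 H2; rewrite (tl_hd_inj H1 H2).
Qed.

Lemma closed_col_bal (cb : @col_balanced r k) j (g : cgkV r k -> nat) :
  \sum_(a | closed_col a == j) g (closed_tl a) = \sum_(a | closed_col a == j) g (closed_hd a).
Proof.
rewrite !big_sumType /=; case: j => [[]|j] /=.
  congr (_ + _); last by rewrite !big_pred0.
  by rewrite big_mkcond [RHS]big_mkcond !big_bool /= ?eqxx addnC.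
by congr (_ + _); [rewrite !big_pred0|apply: cb].
Qed.

Lemma closed_col_conn (cc : @connected_without_colour r bool k) j (x : cgkV r k -> bool) :
  (forall a, closed_col a != j -> x (closed_tl a) = x (closed_hd a)) -> forall u v, x u = x v.
Proof.
case: j => [[]|j] xE u v.
  have H e : x (tl e) = x (hd e) by apply: (xE (inr e)).
  by rewrite (connected H true u) (connected H true v).
have T : x (cgkT r true k) = x (cgkT r false k) := xE (inl true) isT.
have H e : col e != j -> x (tl e) = x (hd e).
  by move=> ej; apply: (xE (inr e)); apply: contraNneq ej => -[->].
have E w : x w = x (cgkT r true k).
  by case: (cc j x H w) => ->.
by rewrite !E.
Qed.

Lemma closed_wt_gt0 a : 0 < closed_wt a.
Proof. by case: a => //= e; apply: wt_gt0. Qed.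

Lemma closed_gt1 : 1 < #|cgkV r k|.
Proof. by move: k_gt0; case: k => // k' _; apply/card_gt1P; exists (inl true), (inl false). Qed.

(** Test functions and sets that avoid the terminals do not see the closing arcs, so
    [circulation_cost] applies. *)
Lemma closed_flow m : balanced_flow closed_tl closed_hd m ->
  connected_flow closed_tl closed_hd m ->
  tour_bound r k - r.+1 ^ k <= \sum_a m a * closed_wt a.
Proof.
move=> mb mc; pose m' e := m (inr e).
have mC : circulation m'.
  move=> g g1 g0; have := mb g; rewrite !big_sumType /= !big_bool /=.
  by rewrite g1 g0 !muln0 !add0n.
have mU : leaves_inner_sets m'.
  move=> U U1 U0 Ux; have [||[b|e]] := mc U => //; first by exists (cgkT r true k).
    by case: b => /and3P[] /=; rewrite ?(negPf U1) ?(negPf U0).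
  by exists e.
have := circulation_cost r_gt0 mC mU.
have : unbalanced m' <= 1 by case: unbalanced.
rewrite big_sumType /= -[\sum_e m (inr e) * _]/(\sum_e m' e * wt e).
move: (\sum_e m' e * wt e) (nat_of_bool _) (r.+1 ^ k) (tour_bound r k) => X u P B u1.
nia.
Qed.

End ClosedGraph.

(** * Numerical estimates *)

Definition total_wt r k := (\sum_(e : cgkA r k) wt e)%N.

Section Numbers.
Local Open Scope nat_scope.
Variable r : nat.

Lemma total_wtS k : total_wt r k.+1 = r * total_wt r k + 2 * r.+1 ^ k.+1.
Proof.
rewrite /total_wt sum_cgkA /= !sum_nat_const !card_ord expnS.
move: (r.+1 ^ k) (\sum_e wt e) => P X; lia.
Qed.

(** The two recursions differ only in their inhomogeneous terms, $2(r-1)(r+1)^k$ and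
    $2(r+1)^{k+1}$. *)
Lemma tour_bound_total k : 0 < r -> r.+1 * tour_bound r k = r.-1 * total_wt r k.
Proof.
move=> r0; elim: k => [|k IH]; first by rewrite /total_wt big1 ?muln0 // => -[].
by rewrite total_wtS /= expnS; nia.
Qed.

Lemma total_wt_le k : total_wt r k <= 2 * k * r.+1 ^ k.
Proof.
elim: k => [|k IH]; first by rewrite /total_wt big1 // => -[].
by rewrite total_wtS expnS; move: (r.+1 ^ k) IH => P; nia.
Qed.

(** The total weight is $2(r+1)^k\sum_{i<k}(r/(r+1))^i$, and each summand is at least
    $1-i/(r+1)$. *)
Lemma total_wt_ge k : 2 * k * r.+1 ^ k.+1 <= r.+1 * total_wt r k + k ^ 2 * r.+1 ^ k.
Proof.
elim: k => [|k IH]; first by rewrite muln0.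
have := total_wt_le k; rewrite total_wtS !expnS in IH *.
move: (r.+1 ^ k) (total_wt r k) IH => P T.
nia.
Qed.

(** Write $P=(r+1)^k$. The total $T$ is about $2kP$, so $k\ge0.6N$ makes it exceed $NP$, with room
    for the deficit $T-B=2T/(r+1)$, which $r=20N$ keeps small. *)
Lemma tour_bound_ge N k : 10 <= N -> r = 20 * N -> 6 * N <= 10 * k <= 7 * N ->
  N * (2 + total_wt r k + r.+1 ^ k) <= total_wt r k + N * tour_bound r k.
Proof.
move=> N10 rN /andP[k1 k2]; have r0 : 0 < r by lia.
have := tour_bound_total k r0; have := total_wt_le k; have := total_wt_ge k.
have : 200 <= r.+1 ^ k.
  have k0 : 0 < k by lia.
  apply: leq_trans (_ : r.+1 ^ 1 <= _); first by rewrite expn1; lia.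
  by rewrite leq_exp2l.
rewrite expnS; move: (r.+1 ^ k) (total_wt r k) (tour_bound r k) => P T B P200 F2 F1 TB.
(* The claim times $100(r+1)$, divided by $P$; 101 instead of 100 absorbs the closing arcs, as
   $P\ge200$. *)
have coef : 101 * r.+1 * N + 400 * k * N + 100 * k ^ 2 <= 200 * k * r.+1.
  have kN : 6 * N * N <= 10 * k * N by rewrite leq_mul2r k1 orbT.
  have kk : 10 * k * k <= 7 * N * k by rewrite leq_mul2r k2 orbT.
  have NN : 10 * N <= N * N by rewrite leq_mul2r N10 orbT.
  by rewrite rN; lia.
have C := leq_mul coef (leqnn P).
have NT := leq_mul (leqnn N) F1.
have NP : r.+1 * N * 200 <= r.+1 * N * P by rewrite leq_mul2l P200 orbT.
have TB' : r.+1 * B + 2 * T = r.+1 * T by rewrite TB; nia.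
have NB := congr1 (muln N) TB'.
rewrite -(@leq_pmul2l (100 * r.+1)) //.
move: C NT NP NB F2; clear; move: (r.+1) => q; lia.
Qed.

End Numbers.

(** Since $25\le z^{1/4}$, the base is at most $z^{5/4}$, and $(5/4)k\le z$. *)
Lemma growth_bound (R : realType) (z : R) (m k : nat) : 25%:R ^+ 4 <= z ->
  m%:R <= 25%:R * z -> 5%:R * k%:R <= 4%:R * z -> (m ^ k)%N%:R <= z `^ z.
Proof.
move=> z0 mz kz; have z1 : 1 <= z by apply: le_trans z0; rewrite exprn_ege1 // ler1n.
have zp : 0 < z by apply: lt_le_trans z1.
have q : 25%:R <= z `^ (4%:R^-1).
  have -> : 25%:R = (25%:R ^+ 4) `^ (4%:R^-1) :> R.
    by rewrite -powR_mulrn ?ler0n // -powRrM mulfV ?pnatr_eq0 // powRr1 ?ler0n.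
  by apply: ge0_ler_powR; rewrite ?nnegrE ?invr_ge0 ?ler0n ?exprn_ge0 ?(ltW zp).
have m54 : m%:R <= z `^ (1 + 4%:R^-1).
  rewrite powRD; last by rewrite (gt_eqF zp) implybT.
  rewrite powRr1 ?(ltW zp) // (mulrC z); apply: le_trans mz _.
  by apply: ler_wpM2r => //; apply: ltW.
rewrite natrX; apply: le_trans (lerXn2r k _ _ m54) _; rewrite ?nnegrE ?ler0n ?powR_ge0 //.
rewrite -powR_mulrn ?powR_ge0 // -powRrM ler_powR //.
by lra.
Qed.

Lemma ratio_bound (R : realType) (eps rho : R) (t N T B P L : nat) : 0 < eps ->
  t.+2%:R / eps <= N%:R -> (N * (2 + T + P) <= T + N * B)%N -> (B <= L + P)%N ->
  L%:R * t.+2%:R <= rho * (t.+1%:R * (2 + T)%N%:R) ->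
  1 + (1 - eps) / t.+1%:R <= rho.
Proof.
move=> eps_gt0; rewrite ler_pdivrMr // => tN.
rewrite -(ler_nat R) !(natrD, natrM) => tb.
rewrite -(ler_nat R) natrD => BP rhoB.
have T0 : 0 <= T%:R :> R by apply: ler0n.
(* [L] misses the total cost $2+T$ by at most the fraction $\epsilon/(t+2)$, so the ratio is at
   least $(t+2-\epsilon)/(t+1)$. *)
have gap : t.+2%:R * (2%:R + T%:R - L%:R) <= eps * (2%:R + T%:R).
  have [D0|D0] := lerP 0 (2%:R + T%:R - L%:R : R); last first.
    apply: (@le_trans _ _ 0); last by rewrite mulr_ge0 ?(ltW eps_gt0) // addr_ge0 ?ler0n.
    by rewrite mulr_ge0_le0 ?ler0n // ltW.
  apply: le_trans (ler_wpM2r D0 tN) _; rewrite mulrAC mulrC ler_pM2l //.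
  have := ler_wpM2l (ler0n R N) BP; lra.
have t1 : 0 < t.+1%:R :> R by rewrite ltr0n.
have T2 : 0 < 2%:R + T%:R :> R by rewrite ltr_wpDr // ltr0n.
rewrite -(ler_pM2r (mulr_gt0 t1 T2)); apply: le_trans rhoB.
have clear_denominator (x y : R) : x != 0 -> (1 + (1 - eps) / x) * (x * y) = (x + 1 - eps) * y.
  by move=> x0; field.
rewrite clear_denominator ?gt_eqF //.
by move: gap; rewrite natr1; lra.
Qed.

Theorem theorem4 (R : realType) :
  exists (C : R) (t0 : nat) (eps0 : R), 0 < eps0 /\
  forall (t : nat) (eps : R), 0 < eps -> eps < eps0 ->
  exists (G : cost_digraph R) (c' : vertex G -> vertex G -> R) (rho : R),
    [/\ #|vertex G|%:R <= C * growth t0 t eps,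
        is_metric_completion c',
        is_integrality_ratio t c' rho
      & 1 + (1 - eps) / t.+1%:R <= rho].
Proof.
(* The threshold 20 gives $t+2\le1.1\max(t,20)$, and $\epsilon<25^{-4}$ gives $z\ge25^4$ for
   [growth_bound]. *)
exists 1, 20%N, (25%:R ^+ 4)^-1; split; first by rewrite invr_gt0 exprn_gt0 // ltr0n.
move=> t eps eps_gt0 eps_lt; pose z : R := (maxn t 20)%:R / eps.
have inv_eps : 25%:R ^+ 4 < eps^-1.
  by rewrite -(invrK (25%:R ^+ 4)) ltf_pV2 // ?posrE ?invr_gt0 ?exprn_gt0 ?ltr0n.
pose N := (Num.truncn (t.+2%:R / eps)).+1.
(* [k] is even because the cells recurse in steps of two, and lies between $0.6N$ and $0.7N$; since
   $N$ is about $1.1z$ at most, $k\le0.8z$. *)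
pose r := (20 * N)%N; pose n := ((3 * N) %/ 10)%N; pose k := (n.+1).*2.
have NR : t.+2%:R / eps <= N%:R by apply/ltW/truncnS_gt.
have NR' : N%:R <= t.+2%:R / eps + 1.
  by rewrite /N -natr1 lerD2r truncn_le // divr_ge0 ?ler0n // ltW.
have maxE : 10%:R * (t.+2%:R / eps) <= 11%:R * z.
  rewrite /z !mulrA ler_pM2r ?invr_gt0 // -!natrM ler_nat.
  by move: (leq_maxl t 20) (leq_maxr t 20); lia.
have z_ge : 25%:R ^+ 4 <= z.
  apply: le_trans (ltW inv_eps) _; rewrite /z ler_peMl ?invr_ge0 ?(ltW eps_gt0) //.
  by rewrite ler1n (leq_trans _ (leq_maxr t 20)).
have z100 : 100%:R <= z.
  by apply: le_trans z_ge; rewrite -natrX ler_nat (@leq_trans (25 ^ 2)) // leq_exp2l.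
have N20 : (20 <= N)%N.
  rewrite -(ler_nat R); apply: le_trans NR; apply: (@le_trans _ _ eps^-1); last first.
    by rewrite ler_peMl ?invr_ge0 ?(ltW eps_gt0) // ler1n.
  by apply: le_trans (ltW inv_eps); rewrite -natrX ler_nat (@leq_trans (25 ^ 1)) // leq_exp2l.
have kN : (6 * N <= 10 * k <= 7 * N)%N.
  have nN : (10 * n <= 3 * N < 10 * n + 10)%N by rewrite /n; lia.
  by rewrite /k doubleS -addnn; lia.
have r_gt0 : (0 < r)%N by rewrite /r; lia.
have k_gt0 : (0 < k)%N by [].
have [c [rho [cM rhoR rhoL]]] := network_ratio R (closed_neq (r := r) k_gt0)
  (closed_inj r_gt0 k_gt0) (closed_col_bal (@col_balanced_double r n.+1))
  (closed_col_conn (@connected_without_colour_double r bool n.+1))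
  (@closed_wt_gt0 r k) (closed_gt1 r k_gt0) (inl tt) t (closed_flow r_gt0 k_gt0).
have totE : (\sum_(a : closedA r k) closed_wt a = 2 + total_wt r k)%N.
  by rewrite big_sumType big_bool.
rewrite totE in rhoL.
exists (network R (@closed_wt r k) (closed_neq (r := r) k_gt0)), c, rho; split=> //.
  rewrite mul1r; apply: le_trans (growth_bound (m := r.+2) (k := k) z_ge _ _).
  - by rewrite ler_nat card_cgkV.
  - have -> : r.+2%:R = 20%:R * N%:R + 2%:R :> R by rewrite /r -addn2 natrD natrM.
    lra.
  - have : 10%:R * k%:R <= 7%:R * N%:R :> R.
      by rewrite -!natrM ler_nat; case/andP: kN.
    lra.
apply: (ratio_bound eps_gt0 NR (tour_bound_ge _ (erefl : r = 20 * N)%N kN) _ rhoL).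
  exact: leq_trans N20.
by rewrite addnC -leq_subLR.
Qed.
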